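(* Let $\alpha>0$ and $\beta>-\alpha/n$, and let $\mathrm{SPD}(n)$ carry the affine-invariant Riemannian metric $$g_\Sigma(X,X)=\alpha\,\mathrm{tr}\big((\Sigma^{-1}X)^2\big)+\beta\,\mathrm{tr}(\Sigma^{-1}X)^2 .$$ Let $p=\sqrt{(\alpha+n\beta)/\alpha}$ and, for $i,j\in\{1,\dots,n\}$, let $E^\beta_{ij}=E_{ij}+\frac{1-p}{np}\delta_{ij}I_n$. Then for every $\Sigma\in\mathrm{SPD}(n)$ the sectional curvature $\kappa$ of $g$ at $\Sigma$ satisfies $$\kappa(\Sigma^{1/2}E^\beta_{ii}\Sigma^{1/2},\Sigma^{1/2}E^\beta_{ij}\Sigma^{1/2})=-\frac{1}{4\alpha}\quad\text{for } i\ne j,$$ $$\kappa(\Sigma^{1/2}E^\beta_{ij}\Sigma^{1/2},\Sigma^{1/2}E^\beta_{ik}\Sigma^{1/2})=-\frac{1}{8\alpha}\quad\text{for } i,j,k \text{ pairwise distinct},$$ and the sectional curvatures of all other pairs of distinct elements of the basis $(\Sigma^{1/2}E^\beta_{ij}\Sigma^{1/2})_{1\le i\le j\le n}$ of $T_\Sigma\mathrm{SPD}(n)$ are zero.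
   Context: $\mathrm{SPD}(n)$ is the manifold of real symmetric positive definite $n\times n$ matrices, an open subset of the space $\mathrm{Sym}(n)$ of symmetric matrices; $T_\Sigma\mathrm{SPD}(n)$ is identified with $\mathrm{Sym}(n)$. $(C_{ij})$ is the canonical basis of $n\times n$ matrices, $E_{ii}=C_{ii}$ and $E_{ij}=\frac{1}{\sqrt2}(C_{ij}+C_{ji})$ for $i\ne j$ (so $E_{ij}=E_{ji}$). $\delta_{ij}$ is the Kronecker symbol. The sectional curvature is $\kappa(X,Y)=\frac{R(X,Y,X,Y)}{\|X\|^2\|Y\|^2-\langle X,Y\rangle^2}$ with the sign convention $R(X,Y,X,Y)=g(R(X,Y)Y,X)$, $R(X,Y)Z=\nabla_X\nabla_YZ-\nabla_Y\nabla_XZ-\nabla_{[X,Y]}Z$ (positive on round spheres). *)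

(* Defs.v *)
From HB Require Import structures.
From mathcomp Require Import all_boot all_order all_algebra.
From mathcomp Require Import all_classical all_reals all_analysis.

Set Implicit Arguments.
Unset Strict Implicit.
Unset Printing Implicit Defensive.

Import Order.TTheory GRing.Theory Num.Theory.
Import numFieldNormedType.Exports.

Local Open Scope classical_set_scope.
Local Open Scope ring_scope.

(* All derivatives of all orders exist: f is C^oo on the open set U. *)
Fixpoint diff_upto (R : realType) (V W : normedModType R) (U : set V)
    (k : nat) (f : V -> W) : Prop :=
  if k is k'.+1 then
    (forall x, U x -> differentiable f x) /\
    (forall v, diff_upto U k' (fun x => 'D_v f x))
  else True.

Definition smooth_on (R : realType) (V W : normedModType R) (U : set V)
    (f : V -> W) : Prop := forall k, diff_upto U k f.

Definition Sym (R : realType) (n : nat) : {vspace 'M[R]_n} :=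
  fixedSpace (linfun (@trmx R n n)).

Lemma SymP (R : realType) (n : nat) (A : 'M[R]_n) :
  reflect (A^T = A) (A \in Sym R n).
Proof. by apply: (iffP fixedSpaceP); rewrite lfunE. Qed.

Definition SPD (R : realType) (n : nat) : set 'M[R]_n :=
  [set S | S \in Sym R n /\
           forall u : 'cV[R]_n, u != 0 -> 0 < (u^T *m S *m u) 0 0].

(* The symmetric positive definite square root. *)
Definition sqrtSPD (R : realType) (n : nat) (S : 'M[R]_n) : 'M[R]_n :=
  get [set B | SPD B /\ B *m B = S].

Definition sym_part (R : realType) (n : nat) (A : 'M[R]_n) : 'M[R]_n :=
  2^-1 *: (A + A^T).

(* Functions and vector fields on SPD(n) are represented by functions on all
   n x n matrices, of which only the values on SPD(n) matter.  SPD(n) is open in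
   Sym(n) but not in 'M_n, so smoothness is tested after composition with the
   linear projection sym_part onto Sym(n), on the preimage of SPD(n), which is
   open in 'M_n.  No such care is needed for 'D_V f S with S in SPD(n) and V
   symmetric, since the line S + tV stays in Sym(n). *)
Definition smoothSPD (R : realType) (n : nat) (W : normedModType R)
    (f : 'M[R]_n -> W) : Prop :=
  smooth_on (@sym_part R n @^-1` @SPD R n) (f \o @sym_part R n).

Definition vector_field (R : realType) (n : nat) (X : 'M[R]_n -> 'M[R]_n) :
    Prop :=
  smoothSPD X /\ forall S, SPD S -> X S \in Sym R n.

Definition lie_bracket (R : realType) (n : nat) (X Y : 'M[R]_n -> 'M[R]_n) :
    'M[R]_n -> 'M[R]_n :=
  fun S => 'D_(X S) Y S - 'D_(Y S) X S.

(* A field of bilinear forms: g S X Y stands for g_S(X, Y). *)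
Definition bilin_field (R : realType) (n : nat) : Type :=
  'M[R]_n -> 'M[R]_n -> 'M[R]_n -> R.

(* nabla X Y stands for the covariant derivative of Y along X. *)
Definition connection_op (R : realType) (n : nat) : Type :=
  ('M[R]_n -> 'M[R]_n) -> ('M[R]_n -> 'M[R]_n) -> ('M[R]_n -> 'M[R]_n).

Record is_levi_civita (R : realType) (n : nat) (g : bilin_field R n)
    (nabla : connection_op R n) : Prop := IsLeviCivita {
  lc_field : forall X Y, vector_field X -> vector_field Y ->
    vector_field (nabla X Y);
  lc_linear : forall (f : 'M[R]_n -> R) X X' Y, smoothSPD f ->
    vector_field X -> vector_field X' -> vector_field Y ->
    forall S, SPD S ->
    nabla (fun T => f T *: X T + X' T) Y S
      = f S *: nabla X Y S + nabla X' Y S;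
  lc_leibniz : forall (f : 'M[R]_n -> R) X Y Y', smoothSPD f ->
    vector_field X -> vector_field Y -> vector_field Y' ->
    forall S, SPD S ->
    nabla X (fun T => f T *: Y T + Y' T) S
      = 'D_(X S) f S *: Y S + f S *: nabla X Y S + nabla X Y' S;
  lc_torsion_free : forall X Y, vector_field X -> vector_field Y ->
    forall S, SPD S ->
    nabla X Y S - nabla Y X S = lie_bracket X Y S;
  lc_metric : forall X Y Z,
    vector_field X -> vector_field Y -> vector_field Z ->
    forall S, SPD S ->
    'D_(X S) (fun T => g T (Y T) (Z T)) S
      = g S (nabla X Y S) (Z S) + g S (Y S) (nabla X Z S)
}.

(* Determined by g on vector fields and at points of SPD(n), the only place
   where it is used. *)
Definition levi_civita (R : realType) (n : nat) (g : bilin_field R n) :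
    connection_op R n :=
  get [set nabla | is_levi_civita g nabla].

Definition curvature (R : realType) (n : nat) (nabla : connection_op R n)
    (X Y Z : 'M[R]_n -> 'M[R]_n) : 'M[R]_n -> 'M[R]_n :=
  fun S => nabla X (nabla Y Z) S - nabla Y (nabla X Z) S
           - nabla (lie_bracket X Y) Z S.

(* R_S(X, Y, X, Y) = g_S(R(X, Y)Y, X).  The curvature is tensorial, so tangent
   vectors may be extended by any vector fields; the constant ones are used. *)
Definition curvature_form (R : realType) (n : nat) (g : bilin_field R n)
    (S X Y : 'M[R]_n) : R :=
  g S (curvature (levi_civita g) (cst X) (cst Y) (cst Y) S) X.

Definition sectional_curvature (R : realType) (n : nat) (g : bilin_field R n)
    (S X Y : 'M[R]_n) : R :=
  curvature_form g S X Y / (g S X X * g S Y Y - g S X Y ^+ 2).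

(* The polarization of alpha tr((S^-1 X)^2) + beta tr(S^-1 X)^2. *)
Definition affine_metric (R : realType) (n : nat) (alpha beta : R) :
    bilin_field R n :=
  fun S X Y => alpha * \tr (invmx S *m X *m (invmx S *m Y))
               + beta * (\tr (invmx S *m X) * \tr (invmx S *m Y)).

Definition Emx (R : realType) (n : nat) (i j : 'I_n) : 'M[R]_n :=
  if i == j then delta_mx i i
  else (Num.sqrt 2)^-1 *: (delta_mx i j + delta_mx j i).

Definition pscale (R : realType) (n : nat) (alpha beta : R) : R :=
  Num.sqrt ((alpha + n%:R * beta) / alpha).

Definition Ebeta (R : realType) (n : nat) (alpha beta : R) (i j : 'I_n) :
    'M[R]_n :=
  let p := pscale n alpha beta in
  Emx R i j + ((1 - p) / (n%:R * p) * (i == j)%:R) *: 1%:M.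

Definition basis_vec (R : realType) (n : nat) (alpha beta : R) (S : 'M[R]_n)
    (i j : 'I_n) : 'M[R]_n :=
  sqrtSPD S *m Ebeta alpha beta i j *m sqrtSPD S.

Definition basis_seq (R : realType) (n : nat) (alpha beta : R) (S : 'M[R]_n) :
    seq 'M[R]_n :=
  [seq basis_vec alpha beta S ij.1 ij.2
     | ij <- enum [pred ij : 'I_n * 'I_n | (ij.1 <= ij.2)%N]].

(* Main.v *)
(** The Levi-Civita connection of [g] is
    [nabla X Y S = D_X Y - 1/2 (X S^-1 Y + Y S^-1 X)].  It does not depend on
    [alpha] and [beta], and gives, with [x = S^-1 X] and [y = S^-1 Y],
    [R(X,Y,X,Y) = alpha/2 (tr (xyxy) - tr (xxyy))], a multiple of the trace of the
    square of a commutator.  Conjugation by [S^1/2] reduces the computation to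
    the identity matrix; there the shift of [E_ii] by a multiple of [I] leaves all
    commutators unchanged and makes the basis orthogonal with squared norms
    [alpha], so that only commutators of the [E_ij] remain. *)

Require Import Defs.
From HB Require Import structures.
From mathcomp Require Import all_boot all_order all_algebra.
From mathcomp Require Import spectral.
From mathcomp Require Import all_classical all_reals all_analysis.
From mathcomp Require Import complex ring lra.

Import Order.TTheory GRing.Theory Num.Theory.
Import numFieldNormedType.Exports.

Set Implicit Arguments.
Unset Strict Implicit.
Unset Printing Implicit Defensive.

Local Open Scope classical_set_scope.
Local Open Scope ring_scope.

(** * Square roots of positive definite matrices *)

Section square_root.
Local Open Scope sesquilinear_scope.

(** Both [sqrtSPD] and [levi_civita] are picked by [get], so all that is known of them comes from
    existence and, for the connection, uniqueness. The axioms of a connection constrain [nabla] only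
    on vector fields and at points of SPD(n). In [nabla X (nabla Y Z)] the explicit formula can
    therefore replace the inner term only because a derivative at a point of SPD(n) in a symmetric
    direction depends on the values on SPD(n) alone. This is where the openness of the preimage of
    SPD(n) under [sym_part] enters. The coefficient [beta] drops out of the curvature because
    tr(S^-1 R(X,Y)Y) = 0. For the final constants, tr(xyxy) - tr(xxyy) equals -1/2 or -1/4 on the
    relevant pairs of E_ij, and the factor alpha/2 is divided by the Gram determinant alpha^2. *)

Definition herm_posdef (C : numClosedFieldType) (n : nat) (A : 'M[C]_n) :=
  A ^t* = A /\ forall u : 'cV[C]_n, u != 0 -> 0 < (u ^t* *m A *m u) 0 0.

Lemma trmxC_mul (C : numClosedFieldType) m n p (A : 'M[C]_(m, n)) (B : 'M[C]_(n, p)) :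
  (A *m B) ^t* = B ^t* *m A ^t*.
Proof. by rewrite trmx_mul map_mxM. Qed.

(** Diagonalize A = P^* D P with P unitary. The eigenvalues in D are positive, and P^* D^(1/2) P is
    the root. *)
Lemma herm_posdef_sqrt (C : numClosedFieldType) (n : nat) (A : 'M[C]_n) :
  herm_posdef A -> exists2 B, herm_posdef B & B *m B = A.
Proof.
move=> [hA pA].
have nA : A \is normalmx by apply/normalmxP; rewrite hA.
have /orthomx_spectralP := nA; set P := spectralmx A; set D := spectral_diag A.
have uP : P \is unitarymx := spectral_unitarymx A.
have PPh := unitarymxP uP; rewrite invmx_unitary// => AE.
have PhP : P ^t* *m P = 1%:M by apply: mulmx1C.
have dgt0 i : 0 < D 0 i.
  (* The i-th column of P^* is an eigenvector, at which the form of A takes the value [D 0 i]. *)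
  have := pA (P ^t* *m delta_mx i 0).
  have -> : P ^t* *m delta_mx i 0 != 0 :> 'cV[C]_n.
    apply/eqP => /(congr1 (mulmx P)); rewrite mulmxA PPh mul1mx mulmx0.
    by move=> /matrixP/(_ i 0); rewrite !mxE !eqxx; apply/eqP/oner_neq0.
  move=> /(_ isT); rewrite trmxC_mul trmxCK AE !mulmxA.
  rewrite -(mulmxA _ P) PPh mulmx1 -(mulmxA _ P) PPh mulmx1.
  suff -> : (((delta_mx i 0 : 'cV[C]_n) ^t*) *m diag_mx D
             *m (delta_mx i 0 : 'cV[C]_n)) 0 0 = D 0 i by [].
  rewrite -colE !mxE (bigD1 i)//= big1 ?addr0; last first.
    by move=> k ki; rewrite !mxE (negPf ki) mulr0n mulr0.
  by rewrite !mxE !eqxx /= mulr1n conjC1 mul1r.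
pose E : 'rV[C]_n := \row_i sqrtC (D 0 i).
have egt0 i : 0 < E 0 i by rewrite mxE sqrtC_gt0.
exists (P ^t* *m diag_mx E *m P).
  split.
    rewrite !trmxC_mul trmxCK mulmxA tr_diag_mx map_diag_mx.
    congr (_ *m diag_mx _ *m _); apply/rowP => i; rewrite !mxE.
    by apply/CrealP; rewrite ger0_real// sqrtC_ge0 ltW.
  move=> u u0; pose w := P *m u.
  have -> : u ^t* *m (P ^t* *m diag_mx E *m P) *m u = w ^t* *m diag_mx E *m w.
    by rewrite /w trmxC_mul !mulmxA.
  have w0 : w != 0.
    apply: contraNneq u0 => w0.
    apply/eqP; rewrite -[LHS]mul1mx -PhP -mulmxA -/w w0 mulmx0; reflexivity.
  have /cV0Pn[i wi] := w0.
  have -> : (w ^t* *m diag_mx E *m w) 0 0 = \sum_k E 0 k * `|w k 0| ^+ 2.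
    rewrite mul_mx_diag mxE; apply: eq_bigr => k _.
    by rewrite !mxE normCK; ring.
  rewrite (bigD1 i)//= ltr_wpDr//.
    by apply: sumr_ge0 => k _; rewrite mulr_ge0 ?exprn_ge0// ltW.
  by rewrite mulr_gt0// exprn_gt0// normr_gt0.
rewrite !mulmxA -(mulmxA _ P) PPh mulmx1 -(mulmxA _ (diag_mx E) (diag_mx E)) mulmx_diag AE.
congr (_ *m diag_mx _ *m _); apply/rowP => i; rewrite !mxE.
by rewrite -expr2 sqrtCK.
Qed.

(** The j-th diagonal entry of D^* B D is the form of B at the j-th column of D, so the trace is a
    sum of nonnegative terms that vanish only at zero columns. *)
Lemma herm_posdef_trace (C : numClosedFieldType) (n : nat) (B D : 'M[C]_n) :
  herm_posdef B -> 0 <= \tr (D ^t* *m B *m D) ?= iff (D == 0).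
Proof.
move=> [_ pB].
have diagE j : (D ^t* *m B *m D) j j = ((col j D) ^t* *m B *m col j D) 0 0.
  rewrite -!mulmxA mxE [RHS]mxE; apply: eq_bigr => k _; congr (_ * _).
    by rewrite !mxE.
  by rewrite colE !mulmxA -colE [RHS]mxE.
have ge0 j : 0 <= (D ^t* *m B *m D) j j.
  rewrite diagE; have [->|c0] := eqVneq (col j D) 0; last exact/ltW/pB.
  by rewrite mulmx0 mxE.
split; first exact: sumr_ge0.
apply/eqP/eqP => [|->]; last by rewrite mulmx0 mxtrace0.
move=> /esym/eqP; rewrite psumr_eq0// => /allP z.
apply/matrixP => i j; rewrite mxE.
have [/colP/(_ i)|c0] := eqVneq (col j D) 0; first by rewrite !mxE.
have := z j (mem_index_enum j); rewrite diagE /= => /eqP z'.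
by have := pB _ c0; rewrite z' ltxx.
Qed.

(* With D = B1 - B2 one has B1 D + D B2 = 0, so tr(D B1 D) + tr(D B2 D) = 0,
   and both traces are nonnegative. *)
Lemma herm_posdef_sqrt_inj (C : numClosedFieldType) (n : nat) (B1 B2 : 'M[C]_n) :
  herm_posdef B1 -> herm_posdef B2 -> B1 *m B1 = B2 *m B2 -> B1 = B2.
Proof.
move=> p1 p2 e; pose D := B1 - B2.
have hD : D ^t* = D.
  by rewrite /D raddfB /= map_mxB p1.1 p2.1.
have z : B1 *m D + D *m B2 = 0.
  by rewrite /D mulmxBr mulmxBl e addrA subrK subrr.
have [g1 e1] := herm_posdef_trace D p1; have [g2 _] := herm_posdef_trace D p2.
have : \tr (D ^t* *m B1 *m D) + \tr (D ^t* *m B2 *m D) = 0.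
  rewrite hD (mxtrace_mulC (D *m B2)) mulmxA -(mulmxA D B1) -(mulmxA D D) -raddfD /=.
  by rewrite -mulmxDr z mulmx0 mxtrace0.
move/eqP; rewrite paddr_eq0// => /andP[t1 _].
by move: e1; rewrite eq_sym t1 => /esym/eqP/eqP; rewrite subr_eq0 => /eqP.
Qed.

(** Expands a Hermitian form at a vector a + ib. For M real symmetric the imaginary part cancels,
    leaving the sum of the real forms at a and b. *)
Lemma mulmx_conj_rect (C : numClosedFieldType) (n : nat) (x y : 'rV[C]_n)
    (M : 'M[C]_n) (z w : 'cV[C]_n) :
  (x - 'i *: y) *m M *m (z + 'i *: w)
    = x *m M *m z + y *m M *m w + 'i *: (x *m M *m w - y *m M *m z).
Proof.
rewrite mulmxDr -scalemxAr !mulmxBl -!scalemxAl !scalerBr scalerA -expr2 sqrCi.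
by rewrite scaleN1r opprK [X in _ + X]addrC addrACA [X in _ + X = _]addrC.
Qed.

(** The root is found over [R[i]]. Since S is real, the entrywise conjugate of a positive definite
    root B is again one, so B is real by uniqueness. *)
Lemma SPD_sqrt_ex (R : realType) (n : nat) (S : 'M[R]_n) :
  SPD S -> exists B, SPD B /\ B *m B = S.
Proof.
move=> [/SymP symS pS].
pose toC := (real_complex R : {rmorphism R -> R[i]}).
pose A := map_mx toC S.
have conjtoC (x : R) : (toC x)^* = toC x by apply/CrealP; rewrite complex_real.
have conjmap m p (M : 'M[R]_(m, p)) : map_mx Num.conj (map_mx toC M) = map_mx toC M.
  by apply/matrixP => i j; rewrite !mxE conjtoC.
have conjmxK m p (M : 'M[R[i]]_(m, p)) : map_mx Num.conj (map_mx Num.conj M) = M.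
  by apply/matrixP => i j; rewrite !mxE conjCK.
have pA : herm_posdef A.
  split; first by rewrite /A map_trmx conjmap symS.
  move=> u u0.
  have [a [b uE]] : exists a b, u = map_mx toC a + 'i *: map_mx toC b.
    exists (map_mx (@complex.Re R) u), (map_mx (@complex.Im R) u).
    by apply/matrixP => i j; rewrite !mxE; exact: complexE.
  have uhE : u ^t* = map_mx toC a^T - 'i *: map_mx toC b^T.
    by apply/matrixP => i j; rewrite uE !mxE rmorphD rmorphM /= conjCi !conjtoC mulNr.
  have sym : b^T *m S *m a = a^T *m S *m b.
    have -> : a^T *m S *m b = (b^T *m S *m a)^T.
      by rewrite !trmx_mul trmxK symS mulmxA.
    by apply/matrixP => i j; rewrite !ord1 [RHS]mxE.
  have -> : (u ^t* *m A *m u) 0 0 =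
    toC ((a^T *m S *m a) 0 0 + (b^T *m S *m b) 0 0).
    rewrite uhE uE mulmx_conj_rect /A -!map_mxM sym subrr scaler0 addr0.
    rewrite -map_mxD mxE; congr (real_complex R _).
    by rewrite mxE.
  have [a0|a0] := eqVneq a 0.
    have b0 : b != 0.
      apply: contraNneq u0 => b0.
      by rewrite uE a0 b0 !map_mx0 scaler0 addr0.
    rewrite -[0]/(toC 0) /toC /= ltcR a0 mulmx0 mxE add0r; exact: pS.
  rewrite -[0]/(toC 0) /toC /= ltcR ltr_wpDr//; last exact: pS.
  have [->|b0] := eqVneq b 0; last exact/ltW/pS.
  by rewrite mulmx0 mxE.
have [B pB BB] := herm_posdef_sqrt pA.
(* The form of the conjugate of B at u is the conjugate of the form of B at the conjugate of u,
   which is a positive real. *)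
have pB' : herm_posdef (map_mx Num.conj B).
  split.
    by rewrite map_trmx pB.1.
  move=> u u0.
  have : 0 < ((map_mx Num.conj u) ^t* *m B *m (map_mx Num.conj u)) 0 0.
    apply: pB.2; apply: contraNneq u0 => /(congr1 (map_mx Num.conj)).
    by rewrite map_mx0 conjmxK => ->.
  move=> p; have := p; rewrite -[in X in X -> _](CrealP (gtr0_real p)).
  suff -> : (((map_mx Num.conj u) ^t* *m B *m (map_mx Num.conj u)) 0 0)^* =
    (u ^t* *m map_mx Num.conj B *m u) 0 0 by [].
  transitivity ((map_mx Num.conj ((map_mx Num.conj u) ^t* *m B *m (map_mx Num.conj u))) 0 0).
    by rewrite [RHS]mxE.
  by rewrite !map_mxM /= map_trmx !conjmxK.
have Breal : map_mx Num.conj B = B.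
  apply: herm_posdef_sqrt_inj => //; rewrite -map_mxM BB /A conjmap//.
have [T BT] : exists T, B = map_mx toC T.
  exists (map_mx (@complex.Re R) B).
  apply/matrixP => i j; rewrite !mxE; apply/esym/RRe_real/CrealP.
  by move/matrixP: Breal => /(_ i j); rewrite mxE.
have toCI m p : injective (@map_mx _ _ toC m p).
  move=> M N /matrixP e; apply/matrixP => i j; have := e i j.
  by rewrite !mxE => /complexI.
exists T; split; last by apply: toCI; rewrite map_mxM -BT BB.
split.
  apply/SymP/toCI; rewrite -map_trmx -BT.
  by rewrite -[LHS]conjmxK pB.1 Breal.
move=> u u0.
have : 0 < ((map_mx toC u) ^t* *m B *m map_mx toC u) 0 0.
  apply: pB.2; apply: contraNneq u0 => z; apply/eqP/toCI.
  by rewrite z map_mx0.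
rewrite map_trmx conjmap BT -!map_mxM mxE.
by rewrite -[0]/(toC 0) /toC /= ltcR.
Qed.

End square_root.

(** * Closure properties of smooth maps *)

(** The increment of h at x vanishes for small arguments, so the zero map serves as the
    differential. This gives the locality of differentiability by way of the difference of two
    maps. *)
Lemma near0_differentiable (R : numFieldType) (V W : normedModType R)
    (h : V -> W) (x : V) :
  (\forall y \near x, h y = 0) -> differentiable h x.
Proof.
move=> h0; have hx : h x = 0 := nbhs_singleton h0.
have e : h \o shift x = cst (h x) + (\0 : {linear V -> W}) +o_ 0 id.
  apply/eqaddoP => eps eps0; near=> y.
  rewrite !fctE /= hx addr0 subr0.
  suff -> : h (y + x) = 0 by rewrite normr0 mulr_ge0// ltW.
  near: y.
  by move: h0; rewrite (near_shift 0 x) /= subr0.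
have c : continuous (\0 : V -> W) by move=> y; exact: cvg_cst.
by apply/diff_locallyP; rewrite (diff_unique c e).
Unshelve. all: by end_near. Qed.

Lemma near_eq_differentiable (R : numFieldType) (V W : normedModType R)
    (f g : V -> W) (x : V) :
  (\forall y \near x, f y = g y) -> differentiable f x -> differentiable g x.
Proof.
move=> fg df; have -> : g = f + (g - f) by rewrite addrC subrK.
apply: differentiableD => //; apply: near0_differentiable.
by apply: filterS fg => y fgy; rewrite !fctE fgy subrr.
Qed.


Section diff_upto.
Context (R : realType) (V : normedModType R) (U : set V) (oU : open U).

Lemma open_near_eq (T : Type) (f g : V -> T) (x : V) :
  (forall y, U y -> f y = g y) -> U x -> \forall y \near x, f y = g y.
Proof. by move=> fg Ux; apply: filterS (open_nbhs_nbhs (conj oU Ux)). Qed.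

(** Openness of U carries an equality on U over to the derivatives, hence to every order.
    Derivatives thus need a closed formula on U only. *)
Lemma diff_upto_ext (W : normedModType R) (k : nat) (f g : V -> W) :
  (forall x, U x -> f x = g x) -> diff_upto U k f -> diff_upto U k g.
Proof.
elim: k f g => //= k IH f g fg [df Df]; split=> [x Ux|v].
  exact: near_eq_differentiable (open_near_eq fg Ux) (df x Ux).
apply: IH (Df v) => x Ux; apply: near_eq_derive.
exact: open_near_eq.
Qed.

Lemma diff_uptoW (W : normedModType R) (k : nat) (f : V -> W) :
  diff_upto U k.+1 f -> diff_upto U k f.
Proof.
elim: k f => //= k IH f [df Df]; split=> // v.
exact: IH (Df v).
Qed.

Lemma diff_upto_cst (W : normedModType R) (k : nat) (c : W) :
  diff_upto U k (fun=> c).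
Proof.
elim: k c => //= k IH c; split=> [x _|v]; first exact: differentiable_cst.
by apply: diff_upto_ext (IH 0) => x _; rewrite derive_cst.
Qed.

Lemma diff_uptoD (W : normedModType R) (k : nat) (f g : V -> W) :
  diff_upto U k f -> diff_upto U k g -> diff_upto U k (fun x => f x + g x).
Proof.
elim: k f g => //= k IH f g [df Df] [dg Dg]; split=> [x Ux|v].
  by apply: differentiableD; [exact: df|exact: dg].
apply: diff_upto_ext (IH _ _ (Df v) (Dg v)) => x Ux.
by rewrite deriveD//; apply: diff_derivable; [exact: df|exact: dg].
Qed.

Lemma diff_uptoM (k : nat) (f g : V -> R) :
  diff_upto U k f -> diff_upto U k g -> diff_upto U k (fun x => f x * g x).
Proof.
elim: k f g => //= k IH f g [df Df] [dg Dg]; split=> [x Ux|v].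
  by apply: differentiableM; [exact: df|exact: dg].
(* The Leibniz rule leaves one factor undifferentiated, so both factors are also needed at order
   k. *)
have fk : diff_upto U k f by apply: diff_uptoW.
have gk : diff_upto U k g by apply: diff_uptoW.
apply: diff_upto_ext (diff_uptoD (IH _ _ fk (Dg v)) (IH _ _ gk (Df v))) => x Ux.
by rewrite deriveM//; apply: diff_derivable; [exact: df|exact: dg].
Qed.

(** The derivative of 1/f is -(1/f)^2 f', so order k of 1/f, given by induction, yields order
    k+1. *)
Lemma diff_uptoV (k : nat) (f : V -> R) :
  (forall x, U x -> f x != 0) ->
  diff_upto U k f -> diff_upto U k (fun x => (f x)^-1).
Proof.
move=> f0; elim: k f f0 => //= k IH f f0 [df Df]; split=> [x Ux|v].
  by apply: differentiableV; [exact: df|exact: f0].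
have fk : diff_upto U k (fun x => (f x)^-1) by apply: IH => //; exact: diff_uptoW.
have := diff_uptoM (diff_upto_cst k (-1 : R)) (diff_uptoM (diff_uptoM fk fk) (Df v)).
apply: diff_upto_ext => x Ux.
rewrite deriveV//; [|exact: f0|apply: diff_derivable; exact: df].
by rewrite mulN1r scaleNr -expr2 exprVn.
Qed.

Lemma diff_upto_sum (W : normedModType R) (k : nat) (I : Type) (r : seq I)
    (P : pred I) (F : I -> V -> W) :
  (forall i, P i -> diff_upto U k (F i)) ->
  diff_upto U k (fun x => \sum_(i <- r | P i) F i x).
Proof.
move=> dF; elim: r => [|i r IH].
  by apply: diff_upto_ext (diff_upto_cst k 0) => x _; rewrite big_nil.
case Pi : (P i); last by apply: diff_upto_ext IH => x _; rewrite big_cons Pi.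
by apply: diff_upto_ext (diff_uptoD (dF i Pi) IH) => x _; rewrite big_cons Pi.
Qed.

Lemma diff_upto_prod (k : nat) (I : Type) (r : seq I) (P : pred I)
    (F : I -> V -> R) :
  (forall i, P i -> diff_upto U k (F i)) ->
  diff_upto U k (fun x => \prod_(i <- r | P i) F i x).
Proof.
move=> dF; elim: r => [|i r IH].
  by apply: diff_upto_ext (diff_upto_cst k (1 : R)) => x _; rewrite big_nil.
case Pi : (P i); last by apply: diff_upto_ext IH => x _; rewrite big_cons Pi.
by apply: diff_upto_ext (diff_uptoM (dF i Pi) IH) => x _; rewrite big_cons Pi.
Qed.

Lemma differentiable_mx (m n : nat) (F : V -> 'M[R]_(m, n)) (x : V) :
  (forall i j, differentiable (fun y => F y i j) x) -> differentiable F x.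
Proof.
move=> dF.
have -> : F = \sum_(i < m) \sum_(j < n) (fun y => F y i j *: delta_mx i j).
  apply/funext => y; rewrite fct_sumE [LHS]matrix_sum_delta.
  by apply: eq_bigr => i _; rewrite fct_sumE.
apply: differentiable_sum => i; apply: differentiable_sum => j.
exact: differentiableZl.
Qed.

Lemma diff_upto_mxP (m n k : nat) (F : V -> 'M[R]_(m, n)) :
  diff_upto U k F <-> forall i j, diff_upto U k (fun x => F x i j).
Proof.
have Dij (G : V -> 'M[R]_(m, n)) x v i j :
    differentiable G x -> 'D_v G x i j = 'D_v (fun x => G x i j) x.
  by move=> dG; rewrite derive_mx ?mxE//; exact: diff_derivable.
elim: k F => [|k IH] F; first by split.
split=> [[dF DF] i j|dF].
  split=> [x Ux|v].
    apply: (@differentiable_comp _ _ _ _ F (fun M : 'M[R]_(m, n) => M i j)).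
      exact: dF.
    exact: differentiable_coord.
  have /IH/(_ i j) := DF v; apply: diff_upto_ext => x Ux.
  by rewrite Dij//; exact: dF.
have dF' x : U x -> differentiable F x.
  by move=> Ux; apply: differentiable_mx => i j; exact: (dF i j).1.
split=> // v; apply/IH => i j.
apply: diff_upto_ext ((dF i j).2 v) => x Ux.
by rewrite Dij//; exact: dF'.
Qed.

Lemma diff_upto_mulmx (m n p k : nat) (F : V -> 'M[R]_(m, n))
    (G : V -> 'M[R]_(n, p)) :
  diff_upto U k F -> diff_upto U k G -> diff_upto U k (fun x => F x *m G x).
Proof.
move=> /diff_upto_mxP dF /diff_upto_mxP dG; apply/diff_upto_mxP => i j.
have : diff_upto U k (fun x => \sum_l F x i l * G x l j).
  by apply: diff_upto_sum => l _; exact: diff_uptoM.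
by apply: diff_upto_ext => x _; rewrite mxE.
Qed.

Lemma diff_upto_scalemx (m n k : nat) (f : V -> R) (G : V -> 'M[R]_(m, n)) :
  diff_upto U k f -> diff_upto U k G -> diff_upto U k (fun x => f x *: G x).
Proof.
move=> df /diff_upto_mxP dG; apply/diff_upto_mxP => i j.
by apply: diff_upto_ext (diff_uptoM df (dG i j)) => x _; rewrite mxE.
Qed.

Lemma diff_upto_det (n k : nat) (F : V -> 'M[R]_n) :
  (forall i j, diff_upto U k (fun x => F x i j)) ->
  diff_upto U k (fun x => \det (F x)).
Proof.
move=> dF; apply: diff_upto_sum => s _; apply: diff_uptoM.
  exact: diff_upto_cst.
by apply: diff_upto_prod => i _; exact: dF.
Qed.

(** Cramer's rule: the inverse is the adjugate, polynomial in the entries, divided by the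
    determinant. *)
Lemma diff_upto_invmx (n k : nat) (F : V -> 'M[R]_n) :
  (forall x, U x -> F x \in unitmx) ->
  diff_upto U k F -> diff_upto U k (fun x => invmx (F x)).
Proof.
move=> uF /diff_upto_mxP dF.
have dV : diff_upto U k (fun x => (\det (F x))^-1).
  by apply: diff_uptoV (diff_upto_det dF) => x /uF; rewrite unitmxE unitfE.
have dA : diff_upto U k (fun x => \adj (F x)).
  apply/diff_upto_mxP => i j.
  have : diff_upto U k (fun x => (-1) ^+ (j + i) * \det (row' j (col' i (F x)))).
    apply: diff_uptoM; first exact: diff_upto_cst.
    apply: diff_upto_det => a b.
    by apply: diff_upto_ext (dF (lift j a) (lift i b)) => x _; rewrite !mxE.
  by apply: diff_upto_ext => x _; rewrite mxE.
apply: diff_upto_ext (diff_upto_scalemx dV dA) => x /uF uFx.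
by rewrite /invmx uFx.
Qed.

End diff_upto.

(** * The manifold of positive definite matrices *)

Section SPD.
Context (R : realType) (n : nat).
Implicit Types (S T V W A B : 'M[R]_n).

Local Notation USPD := (@sym_part R n @^-1` @SPD R n).

Lemma sym_part_id A : A \in Sym R n -> sym_part A = A.
Proof.
move=> /SymP As; rewrite /sym_part As -mulr2n -[A *+ 2]scaler_nat scalerA.
by rewrite mulVf ?scale1r// pnatr_eq0.
Qed.

Lemma sym_part_Sym A : sym_part A \in Sym R n.
Proof. by apply/SymP; rewrite /sym_part linearZ /= linearD /= trmxK addrC. Qed.

Lemma sym_partDl V A : V \in Sym R n -> sym_part (V + A) = V + sym_part A.
Proof.
move=> Vs; rewrite -[in RHS](sym_part_id Vs) /sym_part -scalerDr.
by rewrite [(V + A)^T]linearD /= addrACA.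
Qed.

Lemma SPD_Sym S : SPD S -> S \in Sym R n. Proof. by case. Qed.

Lemma SPD_sym_part S : SPD S -> USPD S.
Proof. by move=> Sp; rewrite /= sym_part_id//; exact: SPD_Sym. Qed.

Lemma SPD_unitmx S : SPD S -> S \in unitmx.
Proof.
move=> [_ Sp]; rewrite unitmxE unitfE; apply/det0P => -[v v0 vS].
have : v^T != 0 by rewrite -(inj_eq trmx_inj) trmxK trmx0.
by move=> /Sp; rewrite trmxK vS mul0mx mxE ltxx.
Qed.

Lemma sqrtSPDP S : SPD S -> SPD (sqrtSPD S) /\ sqrtSPD S *m sqrtSPD S = S.
Proof. by move=> /SPD_sqrt_ex; exact: getPex. Qed.

Lemma sqrtSPD_sym S : SPD S -> (sqrtSPD S)^T = sqrtSPD S.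
Proof. by move=> /sqrtSPDP[/SPD_Sym/SymP]. Qed.

Lemma sqrtSPD_unit S : SPD S -> sqrtSPD S \in unitmx.
Proof. by move=> /sqrtSPDP[/SPD_unitmx]. Qed.

Lemma invmx_sqrtSPD S : SPD S ->
  invmx S = invmx (sqrtSPD S) *m invmx (sqrtSPD S).
Proof.
move=> Sp; have Bu := sqrtSPD_unit Sp.
apply: (can_inj (mulKmx (SPD_unitmx Sp))); rewrite mulmxV ?SPD_unitmx//.
rewrite mulmxA -{1}(sqrtSPDP Sp).2 mulmxK// mulmxV//.
Qed.

Lemma invmx_Sym A : A \in Sym R n -> invmx A \in Sym R n.
Proof. by move=> /SymP As; apply/SymP; rewrite trmx_inv As. Qed.

Lemma diff_upto_coord (U : set 'M[R]_n) (k : nat) (i j : 'I_n) : open U ->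
  diff_upto U k (fun A : 'M[R]_n => A i j).
Proof.
move=> oU; case: k => //= k; split=> [x _|v]; first exact: differentiable_coord.
apply: (diff_upto_ext oU) (diff_upto_cst oU k (v i j)) => x _.
have := derive_mx (@derivable_id _ _ x v); rewrite derive_id => /matrixP/(_ i j).
by rewrite mxE.
Qed.

Lemma diff_upto_sym_part (U : set 'M[R]_n) (k : nat) : open U ->
  diff_upto U k (@sym_part R n).
Proof.
move=> oU; apply/(diff_upto_mxP oU) => i j.
apply: (diff_upto_ext oU) (diff_uptoM oU (diff_upto_cst oU k (2^-1 : R))
  (diff_uptoD oU (diff_upto_coord k i j oU) (diff_upto_coord k j i oU))) => x _.
by rewrite !mxE.
Qed.

(* If S = B^2 and T = S + B M B with the entries of M small, then T is
   congruent to the perturbation 1 + M of the identity. *)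
Lemma quad_form_perturb (M : 'M[R]_n) (w : 'cV[R]_n) :
  (forall i j, `|M i j| <= (2 * n%:R)^-1) ->
  2^-1 * \sum_i w i 0 ^+ 2 <= \sum_i w i 0 ^+ 2 + (w^T *m M *m w) 0 0.
Proof.
move=> Ms; rewrite -subr_ge0.
set s := \sum_i _.
suff : - (w^T *m M *m w) 0 0 <= 2^-1 * s by lra.
have -> : - (w^T *m M *m w) 0 0 = \sum_j \sum_i - (w i 0 * M i j * w j 0).
  rewrite mxE -sumrN; apply: eq_bigr => j _; rewrite mxE mulr_suml -sumrN.
  by apply: eq_bigr => i _; rewrite mxE.
(* Half the squared norm is spread over all pairs (i, j), so that the bound holds termwise: |w_i
   M_ij w_j| <= |w_i||w_j|/(2n) <= (w_i^2 + w_j^2)/(4n). *)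
have -> : 2^-1 * s = \sum_(j < n) \sum_(i < n) (4 * n%:R)^-1 * (w i 0 ^+ 2 + w j 0 ^+ 2).
  under eq_bigr do rewrite -mulr_sumr big_split /= sumr_const card_ord -/s.
  rewrite -mulr_sumr big_split /= sumr_const card_ord !sumrMnl -/s -(mulr_natr s n).
  have [n0|n0] := eqVneq (n%:R : R) 0.
    rewrite /s big1 ?mulr0 ?mul0r ?addr0 ?mulr0// => i _.
    by move/eqP: n0; rewrite pnatr_eq0 => /eqP n0; have := ltn_ord i; rewrite {2}n0.
  by field.
apply: ler_sum => j _; apply: ler_sum => i _.
apply: le_trans (ler_norm _) _; rewrite normrN !normrM.
have h : 0 <= (`|w i 0| - `|w j 0|) ^+ 2 by exact: sqr_ge0.
rewrite -(real_normK (num_real (w i 0))) -(real_normK (num_real (w j 0))).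
have := Ms i j; have := normr_ge0 (M i j).
set a := `|w i 0| in h *; set b := `|w j 0| in h *; set m := `|M i j|.
have a0 : 0 <= a := normr_ge0 _; have b0 : 0 <= b := normr_ge0 _.
have -> : (4 * n%:R)^-1 = 2^-1 * (2 * n%:R)^-1 :> R by rewrite -invfM; congr (_ ^-1); ring.
set c := (2 * n%:R)^-1 => m0 mc.
apply: (@le_trans _ _ (a * c * b)); first by rewrite ler_wpM2r// ler_wpM2l.
have c0 : 0 <= c by apply: le_trans mc.
have := mulr_ge0 c0 h; nra.
Qed.

(** With B the root of S, the map [phi T] = B^-1 (sym T - S) B^-1 is continuous and vanishes at
    [T0], so its entries are small nearby. For w = B u the form of sym T at u is |w|^2 + w^T phi(T)
    w, which is at least |w|^2/2. *)
Lemma open_USPD : open USPD.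
Proof.
rewrite openE => T0 /= Sp; rewrite /interior.
set S := sym_part T0 in Sp *.
pose Bi := invmx (sqrtSPD S).
have Bu := sqrtSPD_unit Sp.
pose phi T := Bi *m (sym_part T + - S) *m Bi.
have oT := @openT 'M[R]_n.
have phid : forall k, diff_upto setT k phi.
  move=> k; apply: (diff_upto_mulmx oT); last exact: (diff_upto_cst oT).
  apply: (diff_upto_mulmx oT); first exact: (diff_upto_cst oT).
  by apply: (diff_uptoD oT); [exact: diff_upto_sym_part|exact: (diff_upto_cst oT)].
have phi0 : phi T0 = 0 by rewrite /phi subrr mulmx0 mul0mx.
(* For n = 0 the bound [(2 * n%:R)^-1] is 0 and no neighbourhood can be drawn from it, but there is
   no nonzero vector to test. *)
have [n0|n0] := posnP n.
  near=> T; split; first exact: sym_part_Sym.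
  by move=> u /eqP[]; apply/matrixP => i; have := ltn_ord i; rewrite {2}n0.
have small : \forall T \near T0, forall i j, `|phi T i j| <= (2 * n%:R)^-1.
  suff sij i j : \forall T \near T0, `|phi T i j| <= (2 * n%:R)^-1.
    pose P i j T := `|phi T i j| <= (2 * n%:R)^-1.
    apply: (@filter_forall _ _ (fun i T => forall j, P i j T) _ (nbhs_filter T0)) => i.
    by apply: (@filter_forall _ _ (P i) _ (nbhs_filter T0)) => j; exact: sij.
  have : {for T0, continuous (fun T => phi T i j)}.
    have /(diff_upto_mxP oT)/(_ i j)[d _] := phid 1%N.
    by apply: differentiable_continuous; exact: d.
  move/cvgr_dist_le => /(_ (2 * n%:R)^-1); rewrite invr_gt0 mulr_gt0// ?ltr0n//.
  move=> /(_ isT); apply: filterS => T.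
  by rewrite phi0 mxE sub0r normrN.
apply: filterS small => T Ts; split; first exact: sym_part_Sym.
move=> u u0; pose w := sqrtSPD S *m u.
have w0 : w != 0.
  apply: contraNneq u0 => w0.
  by rewrite -(mulKmx Bu u) -/w w0 mulmx0.
have -> : u^T *m sym_part T *m u = w^T *m w + w^T *m phi T *m w.
  have -> : w^T *m w = u^T *m S *m u.
    by rewrite -[in RHS](sqrtSPDP Sp).2 /w trmx_mul sqrtSPD_sym// !mulmxA.
  have -> : w^T *m phi T *m w = u^T *m (sqrtSPD S *m phi T *m sqrtSPD S) *m u.
    by rewrite /w trmx_mul sqrtSPD_sym// !mulmxA.
  have -> : sqrtSPD S *m phi T *m sqrtSPD S = sym_part T - S.
    by rewrite /phi !mulmxA mulmxV// mul1mx mulmxKV.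
  by rewrite -mulmxDl -mulmxDr addrC subrK.
have wwE : (w^T *m w) 0 0 = \sum_i w i 0 ^+ 2.
  by rewrite mxE; apply: eq_bigr => i _; rewrite mxE expr2.
rewrite mxE wwE; apply: lt_le_trans (quad_form_perturb _ Ts).
rewrite mulr_gt0// lt_def sumr_ge0 => [|i _]; last exact: sqr_ge0.
rewrite andbT; apply: contra w0 => /eqP/psumr_eq0P z.
apply/eqP/matrixP => i j; rewrite ord1 [RHS]mxE; apply/eqP.
by rewrite -sqrf_eq0; apply/eqP; apply: z => // k _; exact: sqr_ge0.
Unshelve. all: by end_near. Qed.

End SPD.

(** * Directional derivatives of matrix-valued maps *)

Section derive_matrix.
Context (R : realType) (V : normedModType R).

Lemma derive_entry (m n : nat) (F : V -> 'M[R]_(m, n)) (x v : V) i j :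
  derivable F x v -> 'D_v F x i j = 'D_v (fun y => F y i j) x.
Proof. by move=> dF; rewrite derive_mx ?mxE. Qed.

Lemma derivable_big_sum (W : normedModType R) (n : nat) (F : 'I_n -> V -> W) (x v : V) :
  (forall i, derivable (F i) x v) -> derivable (fun y => \sum_i F i y) x v.
Proof. by move=> dF; rewrite -fct_sumE; exact: derivable_sum. Qed.

Lemma derive_big_sum (W : normedModType R) (n : nat) (F : 'I_n -> V -> W) (x v : V) :
  (forall i, derivable (F i) x v) ->
  'D_v (fun y => \sum_i F i y) x = \sum_i 'D_v (F i) x.
Proof. by move=> dF; rewrite -fct_sumE; exact: derive_sum. Qed.

Lemma is_derive_mulmx (m n p : nat) (F : V -> 'M[R]_(m, n))
    (G : V -> 'M[R]_(n, p)) (x v : V) :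
  derivable F x v -> derivable G x v ->
  is_derive x v (fun y => F y *m G y) ('D_v F x *m G x + F x *m 'D_v G x).
Proof.
move=> dF dG.
have dF' := (derivable_mxP _ _ _).1 dF; have dG' := (derivable_mxP _ _ _).1 dG.
have E i j : (fun y => (F y *m G y) i j) = (fun y => \sum_k F y i k * G y k j).
  by apply/funext => y; rewrite mxE.
have d : derivable (fun y => F y *m G y) x v.
  apply/derivable_mxP => i j; rewrite E.
  by apply: derivable_big_sum => k; exact: derivableM.
apply: DeriveDef => //; apply/matrixP => i j.
rewrite derive_entry// E derive_big_sum; last by move=> k; exact: derivableM.
rewrite !mxE -big_split; apply: eq_bigr => k _ /=.
by rewrite deriveM// !derive_entry// addrC; congr (_ + _); exact: mulrC.
Qed.

Lemma is_derive_scalemx (m n : nat) (f : V -> R) (G : V -> 'M[R]_(m, n)) (x v : V) :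
  derivable f x v -> derivable G x v ->
  is_derive x v (fun y => f y *: G y) ('D_v f x *: G x + f x *: 'D_v G x).
Proof.
move=> df dG; have dG' := (derivable_mxP _ _ _).1 dG.
have E i j : (fun y => (f y *: G y) i j) = (fun y => f y * G y i j).
  by apply/funext => y; rewrite mxE.
have d : derivable (fun y => f y *: G y) x v.
  by apply/derivable_mxP => i j; rewrite E; exact: derivableM.
apply: DeriveDef => //; apply/matrixP => i j.
rewrite derive_entry// E (deriveM df (dG' i j)) !mxE derive_entry// addrC.
by congr (_ + _); exact: mulrC.
Qed.

Lemma is_derive_mxtrace (n : nat) (F : V -> 'M[R]_n) (x v : V) :
  derivable F x v -> is_derive x v (fun y => \tr (F y)) (\tr ('D_v F x)).
Proof.
move=> dF; have dF' := (derivable_mxP _ _ _).1 dF.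
have d : derivable (fun y => \tr (F y)) x v by exact: derivable_big_sum.
apply: DeriveDef => //; rewrite derive_big_sum//.
by apply: eq_bigr => i _; rewrite derive_entry.
Qed.

End derive_matrix.

(** * Smooth maps and derivatives on SPD(n) *)

Section smoothSPD.
Context (R : realType) (n : nat).
Implicit Types (S T V : 'M[R]_n).

Local Notation USPD := (@sym_part R n @^-1` @SPD R n).
Let oU := @open_USPD R n.

(** A symmetric V commutes with the projection: sym(T + hV) = sym T + hV. Derivatives on SPD(n)
    thereby become derivatives on an open subset of ['M_n]. *)
Lemma growth_rate_sym_part (W : normedModType R) (f : 'M[R]_n -> W) T V :
  V \in Sym R n ->
  (fun h : R => h^-1 *: ((f \o shift (sym_part T)) (h *: V) - f (sym_part T)))
  = (fun h => h^-1 *: (((f \o @sym_part R n) \o shift T) (h *: V)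
                       - (f \o @sym_part R n) T)).
Proof.
move=> Vs; apply/funext => h /=; congr (_ *: (f _ - _)).
by rewrite sym_partDl// memvZ.
Qed.

Lemma derivable_sym_part (W : normedModType R) (f : 'M[R]_n -> W) T V :
  V \in Sym R n -> derivable (f \o @sym_part R n) T V -> derivable f (sym_part T) V.
Proof. by move=> Vs; rewrite /derivable -growth_rate_sym_part. Qed.

Lemma derive_sym_part (W : normedModType R) (f : 'M[R]_n -> W) T V :
  V \in Sym R n -> 'D_V f (sym_part T) = 'D_V (f \o @sym_part R n) T.
Proof. by move=> Vs; rewrite /derive growth_rate_sym_part. Qed.

(** After composition with [sym_part], agreement on SPD(n) is agreement on an open set. Values off
    SPD(n), such as those of [levi_civita], do not affect the derivative. *)
Lemma derive_SPD_ext (W : normedModType R) (f g : 'M[R]_n -> W) S V :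
  (forall T, SPD T -> f T = g T) -> SPD S -> V \in Sym R n ->
  'D_V f S = 'D_V g S.
Proof.
move=> fg Sp Vs; rewrite -(sym_part_id (SPD_Sym Sp)) !derive_sym_part//.
apply: near_eq_derive; apply: (open_near_eq oU); last exact: SPD_sym_part.
by move=> T /= /fg.
Qed.

Lemma smoothSPD_ext (W : normedModType R) (f g : 'M[R]_n -> W) :
  (forall T, SPD T -> f T = g T) -> smoothSPD f -> smoothSPD g.
Proof. by move=> fg sf k; apply: (diff_upto_ext oU) (sf k) => T /= /fg. Qed.

Lemma smoothSPD_derivable (W : normedModType R) (f : 'M[R]_n -> W) S V :
  smoothSPD f -> SPD S -> V \in Sym R n -> derivable f S V.
Proof.
move=> sf Sp Vs; rewrite -(sym_part_id (SPD_Sym Sp)).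
apply: derivable_sym_part => //; apply: diff_derivable.
by apply: (sf 1%N).1; exact: SPD_sym_part.
Qed.

Lemma smoothSPD_deriveE (W : normedModType R) (f : 'M[R]_n -> W) T V :
  smoothSPD f -> USPD T -> V \in Sym R n ->
  'D_V f (sym_part T) = 'd (f \o @sym_part R n) T V.
Proof.
by move=> sf UT Vs; rewrite derive_sym_part// deriveE//; exact: (sf 1%N).1.
Qed.

Lemma derive_SPD_linear (W : normedModType R) (f : 'M[R]_n -> W) S V V' a :
  smoothSPD f -> SPD S -> V \in Sym R n -> V' \in Sym R n ->
  'D_(a *: V + V') f S = a *: 'D_V f S + 'D_V' f S.
Proof.
move=> sf Sp Vs V's; have US := SPD_sym_part Sp.
rewrite -(sym_part_id (SPD_Sym Sp)) !smoothSPD_deriveE//.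
  exact: linearP.
by rewrite memvD// memvZ.
Qed.

Lemma smoothSPD_cst (W : normedModType R) (c : W) : smoothSPD (cst c : 'M[R]_n -> W).
Proof. by move=> k; exact: (diff_upto_cst oU). Qed.

Lemma smoothSPDD (W : normedModType R) (f g : 'M[R]_n -> W) :
  smoothSPD f -> smoothSPD g -> smoothSPD (fun T => f T + g T).
Proof. by move=> sf sg k; exact: (diff_uptoD oU (sf k) (sg k)). Qed.

Lemma smoothSPD_mulmx (m p q : nat) (F : 'M[R]_n -> 'M[R]_(m, p))
    (G : 'M[R]_n -> 'M[R]_(p, q)) :
  smoothSPD F -> smoothSPD G -> smoothSPD (fun T => F T *m G T).
Proof. by move=> sF sG k; exact: (diff_upto_mulmx oU (sF k) (sG k)). Qed.

Lemma smoothSPD_scalemx (m p : nat) (f : 'M[R]_n -> R) (G : 'M[R]_n -> 'M[R]_(m, p)) :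
  smoothSPD f -> smoothSPD G -> smoothSPD (fun T => f T *: G T).
Proof. by move=> sf sG k; exact: (diff_upto_scalemx oU (sf k) (sG k)). Qed.

Lemma smoothSPD_invmx : smoothSPD (@invmx R n).
Proof.
move=> k; apply: (diff_upto_invmx oU); last exact: diff_upto_sym_part.
by move=> T; exact: SPD_unitmx.
Qed.

(** [diff_upto] controls derivatives in fixed directions only, so the variable direction X(T) is
    expanded over the matrices [delta_mx i j]. These need not be symmetric, hence the passage to F
    composed with [sym_part]. *)
Lemma smoothSPD_derive (m p : nat) (X : 'M[R]_n -> 'M[R]_n) (F : 'M[R]_n -> 'M[R]_(m, p)) :
  vector_field X -> smoothSPD F -> smoothSPD (fun T => 'D_(X T) F T).
Proof.
move=> [sX Xs] sF k.
have : diff_upto USPD k (fun T => \sum_i \sum_j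
    X (sym_part T) i j *: 'D_(delta_mx i j) (F \o @sym_part R n) T).
  apply: (diff_upto_sum oU) => i _; apply: (diff_upto_sum oU) => j _.
  apply: (diff_upto_scalemx oU); last exact: (sF k.+1).2.
  by have /(diff_upto_mxP oU) := sX k; apply.
apply: (diff_upto_ext oU) => T UT /=.
rewrite smoothSPD_deriveE//; last exact: Xs.
have dF : differentiable (F \o @sym_part R n) T by exact: (sF 1%N).1.
rewrite [X (sym_part T) in RHS]matrix_sum_delta linear_sum /=; apply: eq_bigr => i _.
by rewrite linear_sum /=; apply: eq_bigr => j _; rewrite linearZ /= deriveE.
Qed.

(** Differentiate T^-1 T = 1, valid on SPD(n), by the product rule and multiply by S^-1 on the
    right. *)
Lemma derive_invmx S V : SPD S -> V \in Sym R n ->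
  'D_V (@invmx R n) S = - (invmx S *m V *m invmx S).
Proof.
move=> Sp Vs; have Su := SPD_unitmx Sp.
have dV := smoothSPD_derivable smoothSPD_invmx Sp Vs.
have [_ +] := is_derive_mulmx dV (@derivable_id _ _ S V).
rewrite derive_id (@derive_SPD_ext _ _ (cst 1%:M))//; last first.
  by move=> T /SPD_unitmx/mulVmx.
rewrite derive_cst => /esym/eqP; rewrite addr_eq0 => /eqP /(congr1 (mulmx^~ (invmx S))).
by rewrite mulmxK// mulNmx.
Qed.

End smoothSPD.

(** * The Levi-Civita connection and the curvature *)

Section affine_metric.
Context (R : realType) (n : nat) (alpha beta : R).
Implicit Types (S A B C : 'M[R]_n).
Local Notation g := (@affine_metric R n alpha beta).

Lemma affine_metricC S A B : g S A B = g S B A.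
Proof. by rewrite /affine_metric mxtrace_mulC [X in beta * X]mulrC. Qed.

Lemma affine_metricDl S A B C : g S (A + B) C = g S A C + g S B C.
Proof.
by rewrite /affine_metric !mulmxDr mulmxDl !linearD /=; ring.
Qed.

Lemma affine_metricZl S a A C : g S (a *: A) C = a * g S A C.
Proof.
by rewrite /affine_metric -!scalemxAr -!scalemxAl !linearZ /=; ring.
Qed.

Lemma affine_metricBl S A B C : g S (A - B) C = g S A C - g S B C.
Proof. by rewrite affine_metricDl -scaleN1r affine_metricZl mulN1r. Qed.

Lemma affine_metricBr S A B C : g S C (A - B) = g S C A - g S C B.
Proof. by rewrite affine_metricC affine_metricBl !(affine_metricC _ C). Qed.

(** The right-hand side is the metric at the identity: congruence by S^(1/2) is an isometry onto the
    tangent space at S. *)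
Lemma affine_metric_sqrt S A B : SPD S ->
  g S (sqrtSPD S *m A *m sqrtSPD S) (sqrtSPD S *m B *m sqrtSPD S)
    = alpha * \tr (A *m B) + beta * (\tr A * \tr B).
Proof.
move=> Sp; have Qu := sqrtSPD_unit Sp.
have E C : invmx S *m (sqrtSPD S *m C *m sqrtSPD S)
    = invmx (sqrtSPD S) *m C *m sqrtSPD S.
  by rewrite invmx_sqrtSPD// -!mulmxA mulKmx.
have trE C : \tr (invmx (sqrtSPD S) *m C *m sqrtSPD S) = \tr C.
  by rewrite mxtrace_mulC mulKVmx.
rewrite /affine_metric !E !trE; congr (_ * _ + _).
by rewrite !mulmxA mulmxK// -(mulmxA _ A) trE.
Qed.

(** Write S^(-1/2) A S^(-1/2) = N + (t/n) I with N traceless. The form becomes alpha tr(N^2) +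
    (alpha/n + beta) t^2, with both coefficients positive, and tr(N^2) is a sum of squares. *)
Lemma affine_metric_definite S A : (0 < n)%N -> 0 < alpha ->
  - alpha / n%:R < beta -> SPD S -> A \in Sym R n -> g S A A = 0 -> A = 0.
Proof.
move=> n0 a0 bn Sp /SymP As; have Qu := sqrtSPD_unit Sp.
pose M := invmx (sqrtSPD S) *m A *m invmx (sqrtSPD S).
have AE : A = sqrtSPD S *m M *m sqrtSPD S.
  by rewrite /M !mulmxA mulmxV// mul1mx mulmxKV.
have Ms : M^T = M.
  by rewrite /M !trmx_mul As trmx_inv sqrtSPD_sym// mulmxA.
rewrite {1 2}AE affine_metric_sqrt//.
have nn : (n%:R : R) != 0 by rewrite pnatr_eq0 -lt0n.
set t := \tr M; pose N := M - (t / n%:R)%:M.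
have NN : \tr (M *m M) = \tr (N *m N) + t ^+ 2 / n%:R.
  rewrite /N mulmxBl !mulmxBr -scalar_mxM !mul_scalar_mx mul_mx_scalar.
  rewrite !raddfB /= raddfN /= !mxtraceZ mxtrace_scalar -/t -[_ *+ n]mulr_natr.
  by field.
have Ns : N^T = N by rewrite /N raddfB /= Ms tr_scalar_mx.
have trN : \tr (N *m N) = \sum_i \sum_j N i j ^+ 2.
  apply: eq_bigr => i _; rewrite mxE; apply: eq_bigr => j _; rewrite expr2.
  by congr (_ * _); rewrite -[in LHS]Ns [LHS]mxE.
have trN0 : 0 <= \tr (N *m N).
  by rewrite trN; apply: sumr_ge0 => i _; apply: sumr_ge0 => j _; exact: sqr_ge0.
have c0 : 0 < alpha / n%:R + beta by rewrite mulNr in bn; lra.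
rewrite NN => e.
have e' : alpha * \tr (N *m N) + (alpha / n%:R + beta) * t ^+ 2 = 0.
  by rewrite -e; ring.
move/eqP: e'; rewrite (paddr_eq0 (mulr_ge0 (ltW a0) trN0) (mulr_ge0 (ltW c0) (sqr_ge0 t))).
rewrite !mulf_eq0 (gt_eqF a0) (gt_eqF c0) /= orbb => /andP[/eqP z /eqP t0].
have M0 : M = N by rewrite /N t0 mul0r raddf0 subr0.
suff -> : A = 0 by [].
rewrite AE M0; suff -> : N = 0 by rewrite mulmx0 mul0mx.
apply/matrixP => i j; rewrite [RHS]mxE; apply/eqP; rewrite -sqrf_eq0.
have := z; rewrite trN => /psumr_eq0P zi.
have := zi (fun i _ => sumr_ge0 _ (fun j _ => sqr_ge0 (N i j))) i isT.
by move/psumr_eq0P => -> // k _; exact: sqr_ge0.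
Qed.

End affine_metric.

(** Metric compatibility as an identity of traces, due to cyclicity. Here [I] stands for S^-1, [V]
    for the direction, [y'] and [z'] for the derivatives of the fields [y] and [z], and
    [- (I *m V *m I)] for the derivative of S^-1. *)
Lemma affine_metric_compatible (R : realType) (n : nat) (alpha beta : R)
    (I V y z y' z' : 'M[R]_n) :
  alpha * \tr ((- (I *m V *m I) *m y + I *m y') *m (I *m z)
               + I *m y *m (- (I *m V *m I) *m z + I *m z'))
  + beta * (\tr (I *m y) * \tr (- (I *m V *m I) *m z + I *m z')
            + \tr (I *m z) * \tr (- (I *m V *m I) *m y + I *m y'))
  = alpha * \tr (I *m (y' - 2^-1 *: (V *m I *m y + y *m I *m V)) *m (I *m z))
    + beta * (\tr (I *m (y' - 2^-1 *: (V *m I *m y + y *m I *m V))) * \tr (I *m z))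
    + (alpha * \tr (I *m y *m (I *m (z' - 2^-1 *: (V *m I *m z + z *m I *m V))))
       + beta * (\tr (I *m y) * \tr (I *m (z' - 2^-1 *: (V *m I *m z + z *m I *m V))))).
Proof.
rewrite !(mulmxDl, mulmxDr, mulmxN, mulNmx, =^~ scalemxAl, =^~ scalemxAr) !mulmxA.
rewrite !(mxtraceD, mxtraceZ, raddfN) /= !(mxtraceD, mxtraceZ).
have -> : \tr (I *m y *m I *m z *m I *m V) = \tr (I *m V *m I *m y *m I *m z).
  by rewrite -(mulmxA _ I V) mxtrace_mulC !mulmxA.
have c w : \tr (I *m w *m I *m V) = \tr (I *m V *m I *m w).
  by rewrite -(mulmxA _ I V) mxtrace_mulC !mulmxA.
by rewrite !c; field.
Qed.

Section levi_civita.
Context (R : realType) (n : nat).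
Implicit Types (S : 'M[R]_n) (X Y Z : 'M[R]_n -> 'M[R]_n).

(** The correction term compensates the derivative of S^-1 in the metric. It is symmetric in X and
    Y, so the torsion is that of the flat derivative. *)
Definition affine_nabla : connection_op R n := fun X Y S =>
  'D_(X S) Y S
  - 2^-1 *: (X S *m invmx S *m Y S + Y S *m invmx S *m X S).

Lemma vector_field_cst (A : 'M[R]_n) : A \in Sym R n -> vector_field (cst A).
Proof. by move=> As; split=> //; exact: smoothSPD_cst. Qed.

Lemma derive_Sym X S V : vector_field X -> SPD S -> V \in Sym R n ->
  'D_V X S \in Sym R n.
Proof.
move=> [sX Xs] Sp Vs; apply/SymP/matrixP => i j; rewrite mxE.
have dX := smoothSPD_derivable sX Sp Vs.
rewrite !derive_entry//; apply: derive_SPD_ext => // T /Xs/SymP XT.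
by rewrite -[in LHS]XT mxE.
Qed.

Lemma vector_field_affine_nabla X Y :
  vector_field X -> vector_field Y -> vector_field (affine_nabla X Y).
Proof.
move=> vX vY; have [sX Xs] := vX; have [sY Ys] := vY; split=> [|S Sp].
  have sI := @smoothSPD_invmx R n.
  have sQ := smoothSPD_scalemx (@smoothSPD_cst R n _ (- 2^-1 : R))
    (smoothSPDD (smoothSPD_mulmx (smoothSPD_mulmx sX sI) sY)
                (smoothSPD_mulmx (smoothSPD_mulmx sY sI) sX)).
  apply: smoothSPD_ext (smoothSPDD (smoothSPD_derive vX sY) sQ) => T _.
  by rewrite /affine_nabla scaleNr.
rewrite memvB//; first by apply: derive_Sym => //; exact: Xs.
apply/memvZ/SymP; have /SymP Xt := Xs S Sp; have /SymP Yt := Ys S Sp.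
have /SymP It := invmx_Sym (SPD_Sym Sp).
by rewrite linearD /= !trmx_mul Xt Yt It !mulmxA addrC.
Qed.

Lemma affine_nabla_levi_civita (alpha beta : R) :
  is_levi_civita (@affine_metric R n alpha beta) affine_nabla.
Proof.
split.
- exact: vector_field_affine_nabla.
- move=> f X X' Y sf [_ Xs] [_ X's] [sY _] S Sp.
  rewrite /affine_nabla derive_SPD_linear//; [|exact: Xs|exact: X's].
  rewrite !mulmxDl !mulmxDr -!scalemxAl -!scalemxAr.
  move: (X S *m _ *m _) (X' S *m _ *m _) (Y S *m _ *m X S) (Y S *m _ *m X' S).
  move: ('D_(X S) Y S) ('D_(X' S) Y S) => *.
  by apply/matrixP => i j; rewrite !mxE; ring.
- move=> f X Y Y' sf [_ Xs] [sY _] [sY' _] S Sp.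
  have Vs := Xs S Sp.
  have df := smoothSPD_derivable sf Sp Vs.
  have dY := smoothSPD_derivable sY Sp Vs.
  have dY' := smoothSPD_derivable sY' Sp Vs.
  have [dfY DfY] := is_derive_scalemx df dY.
  rewrite /affine_nabla (deriveD dfY dY') DfY.
  rewrite !mulmxDl !mulmxDr -!scalemxAl -!scalemxAr.
  move: (X S *m _ *m Y S) (X S *m _ *m Y' S) (Y S *m _ *m _) (Y' S *m _ *m _).
  move: ('D_(X S) Y S) ('D_(X S) Y' S) ('D_(X S) f S) (Y S) => *.
  by apply/matrixP => i j; rewrite !mxE; ring.
- move=> X Y vX vY S Sp; rewrite /affine_nabla /lie_bracket.
  rewrite [X in _ - (_ - 2^-1 *: X)]addrC opprB addrA subrK.
  by [].
- move=> X Y Z [_ Xs] [sY Ys] [sZ Zs] S Sp.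
  have Vs := Xs S Sp.
  have dI := smoothSPD_derivable (@smoothSPD_invmx R n) Sp Vs.
  have dY := smoothSPD_derivable sY Sp Vs.
  have dZ := smoothSPD_derivable sZ Sp Vs.
  have [dIY DIY] := is_derive_mulmx dI dY.
  have [dIZ DIZ] := is_derive_mulmx dI dZ.
  have [dP DP] := is_derive_mulmx dIY dIZ.
  have [dtP DtP] := is_derive_mxtrace dP.
  have [dtY DtY] := is_derive_mxtrace dIY.
  have [dtZ DtZ] := is_derive_mxtrace dIZ.
  have [D1 E1] := is_deriveZ alpha (derivableP dtP).
  have [D2 E2] := is_deriveZ beta (is_deriveM (derivableP dtY) (derivableP dtZ)).
  have := deriveD D1 D2; rewrite E1 E2 => ->.
  rewrite DtP DtY DtZ DP DIY DIZ derive_invmx// /affine_nabla /affine_metric.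
  set V := X S; set I := invmx S; set y := Y S; set z := Z S.
  set y' := 'D_V Y S; set z' := 'D_V Z S.
  exact: affine_metric_compatible.
Qed.
Section curvature.
Context (alpha beta : R) (n_gt0 : (0 < n)%N) (alpha_gt0 : 0 < alpha)
  (beta_gt : - alpha / n%:R < beta).
Local Notation g := (@affine_metric R n alpha beta).

(* The difference tensor A(X, Y) of two Levi-Civita connections is symmetric in
   X, Y while g(A(X, Y), Z) is antisymmetric in Y, Z; hence it vanishes. *)
Lemma levi_civita_uniq (nabla nabla' : connection_op R n) X Y S :
  is_levi_civita g nabla -> is_levi_civita g nabla' ->
  vector_field X -> vector_field Y -> SPD S -> nabla X Y S = nabla' X Y S.
Proof.
move=> L L' vX vY Sp.
pose A X Y := nabla X Y S - nabla' X Y S.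
have Asym U W : vector_field U -> vector_field W -> A U W = A W U.
  move=> vU vW; have := lc_torsion_free L vU vW Sp.
  rewrite -(lc_torsion_free L' vU vW Sp) => e.
  rewrite /A -[nabla U W S](subrK (nabla W U S)) e.
  by rewrite addrAC [X in X + _ = _]addrAC subrr add0r addrC.
have Askew U V W : vector_field U -> vector_field V -> vector_field W ->
    g S (A U V) (W S) = - g S (A U W) (V S).
  move=> vU vV vW; apply/eqP; rewrite -addr_eq0 /A !affine_metricBl.
  have := lc_metric L vU vV vW Sp; rewrite (lc_metric L' vU vV vW Sp).
  by rewrite !(affine_metricC _ _ _ (V S)) => e; apply/eqP; lra.
have Azero Z : vector_field Z -> g S (A X Y) (Z S) = 0.
  move=> vZ.
  (* Up to the symmetry of A, three antisymmetric swaps lead from g(A(X, Y), Z) back to its own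
     negative. *)
  have e1 := Askew _ _ _ vX vY vZ; have e2 := Askew _ _ _ vZ vX vY.
  have e3 := Askew _ _ _ vY vZ vX.
  rewrite (Asym _ _ vZ vX) in e2; rewrite (Asym _ _ vY vZ) (Asym _ _ vY vX) in e3.
  lra.
apply/eqP; rewrite -subr_eq0; apply/eqP.
apply: (affine_metric_definite n_gt0 alpha_gt0 beta_gt Sp).
  by rewrite memvB//; [apply: (lc_field L vX vY).2|apply: (lc_field L' vX vY).2].
(* [Azero] tests against vector fields. The two covariant derivatives are such fields, and their
   difference at S is [A X Y] itself. *)
by rewrite affine_metricBr !Azero ?subrr//; [exact: (lc_field L' vX vY)|exact: (lc_field L vX vY)].
Qed.

Lemma levi_civitaP : is_levi_civita g (levi_civita g).
Proof. by apply: getPex; exists affine_nabla; exact: affine_nabla_levi_civita. Qed.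

Lemma levi_civitaE X Y S : vector_field X -> vector_field Y -> SPD S ->
  levi_civita g X Y S = affine_nabla X Y S.
Proof.
exact: levi_civita_uniq levi_civitaP (affine_nabla_levi_civita _ _).
Qed.

Lemma derive_mulmx_invmx (A B : 'M[R]_n) S V : SPD S -> V \in Sym R n ->
  is_derive S V (fun T => A *m invmx T *m B) (- (A *m invmx S *m V *m invmx S *m B)).
Proof.
move=> Sp Vs; have dI := smoothSPD_derivable (@smoothSPD_invmx R n) Sp Vs.
have [d1 D1] := is_derive_mulmx (@derivable_cst _ _ _ A S V) dI.
have [d2 D2] := is_derive_mulmx d1 (@derivable_cst _ _ _ B S V).
apply: DeriveDef; first exact: d2.
rewrite D2 D1 !derive_cst derive_invmx// mul0mx add0r mulmx0 addr0.
by rewrite mulmxN mulNmx !mulmxA.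
Qed.

Lemma levi_civita_cst (X Y : 'M[R]_n) S : X \in Sym R n -> Y \in Sym R n -> SPD S ->
  levi_civita g (cst X) (cst Y) S
    = - 2^-1 *: (X *m invmx S *m Y + Y *m invmx S *m X).
Proof.
move=> Xs Ys Sp; rewrite levi_civitaE//; try exact: vector_field_cst.
by rewrite /affine_nabla derive_cst sub0r scaleNr.
Qed.

(** The terms in [2^-1] come from differentiating S^-1 inside the inner derivative, those in [4^-1]
    from applying the correction term twice. *)
Lemma levi_civita_cst2 (X Y Z : 'M[R]_n) S :
  X \in Sym R n -> Y \in Sym R n -> Z \in Sym R n -> SPD S ->
  let I := invmx S in
  levi_civita g (cst X) (levi_civita g (cst Y) (cst Z)) S
    = 2^-1 *: (Y *m I *m X *m I *m Z + Z *m I *m X *m I *m Y)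
    + 4^-1 *: (X *m I *m Y *m I *m Z + X *m I *m Z *m I *m Y
               + Y *m I *m Z *m I *m X + Z *m I *m Y *m I *m X).
Proof.
move=> Xs Ys Zs Sp I.
have vX := vector_field_cst Xs; have vY := vector_field_cst Ys.
have vZ := vector_field_cst Zs.
rewrite levi_civitaE//; last exact: (lc_field levi_civitaP).
rewrite /affine_nabla levi_civita_cst// -/I.
rewrite (@derive_SPD_ext _ _ _ _
  (fun T => - 2^-1 *: (Y *m invmx T *m Z + Z *m invmx T *m Y)))//; last first.
  by move=> T Tp; rewrite levi_civita_cst.
have [d1 D1] := derive_mulmx_invmx Y Z Sp Xs.
have [d2 D2] := derive_mulmx_invmx Z Y Sp Xs.
rewrite (deriveZ (- 2^-1) (derivableD d1 d2)) (deriveD d1 d2) D1 D2 -/I.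
rewrite -!scalemxAr -!scalemxAl !mulmxDr !mulmxDl !mulmxA.
move: (Y *m I *m X *m I *m Z) (Z *m I *m X *m I *m Y) => *.
move: (X *m I *m Y *m I *m Z) (X *m I *m Z *m I *m Y) => *.
move: (Y *m I *m Z *m I *m X) (Z *m I *m Y *m I *m X) => *.
by apply/matrixP => i j; rewrite !mxE; field.
Qed.

Lemma curvature_cst (X Y : 'M[R]_n) S : X \in Sym R n -> Y \in Sym R n -> SPD S ->
  let I := invmx S in
  curvature (levi_civita g) (cst X) (cst Y) (cst Y) S
    = 2^-1 *: (Y *m I *m X *m I *m Y)
      - 4^-1 *: (X *m I *m Y *m I *m Y + Y *m I *m Y *m I *m X).
Proof.
move=> Xs Ys Sp I; rewrite /curvature !levi_civita_cst2// -/I.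
have -> : lie_bracket (cst X) (cst Y) = cst 0.
  by apply/funext => T; rewrite /lie_bracket !derive_cst subrr.
rewrite levi_civita_cst ?mem0v// !(mul0mx, mulmx0) addr0 scaler0 subr0.
move: (X *m I *m Y *m I *m Y) (Y *m I *m X *m I *m Y) (Y *m I *m Y *m I *m X) => *.
by apply/matrixP => i j; rewrite !mxE; field.
Qed.

Lemma curvature_formE (X Y : 'M[R]_n) S : X \in Sym R n -> Y \in Sym R n -> SPD S ->
  let x := invmx S *m X in let y := invmx S *m Y in
  curvature_form g S X Y
    = alpha / 2 * (\tr (x *m y *m (x *m y)) - \tr (x *m x *m (y *m y))).
Proof.
move=> Xs Ys Sp x y; rewrite /curvature_form curvature_cst// /affine_metric.
rewrite !(mulmxDl, mulmxDr, mulmxN, mulNmx, =^~ scalemxAl, =^~ scalemxAr) !mulmxA.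
rewrite -/x -/y -!(mulmxA _ (invmx S)) -/x -/y.
rewrite !(mxtraceD, mxtraceZ, raddfN) /= !(mxtraceD, mxtraceZ).
(* These two equalities make the trace of S^-1 R(X,Y)Y vanish, and with it the [beta] term. *)
have -> : \tr (y *m y *m x) = \tr (y *m x *m y) by rewrite -mulmxA mxtrace_mulC.
have -> : \tr (x *m y *m y) = \tr (y *m x *m y).
  by rewrite mxtrace_mulC mulmxA.
have -> : \tr (y *m x *m y *m x) = \tr (x *m y *m x *m y).
  by rewrite mxtrace_mulC !mulmxA.
have -> : \tr (y *m y *m x *m x) = \tr (x *m x *m y *m y).
  by rewrite -(mulmxA _ x x) mxtrace_mulC !mulmxA.
have -> : \tr (x *m y *m y *m x) = \tr (x *m x *m y *m y).
  by rewrite mxtrace_mulC !mulmxA.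
by field.
Qed.

End curvature.
End levi_civita.

(** * The basis *)

Section comm_defect.
Context (R : comPzRingType) (n : nat).
Implicit Types A B : 'M[R]_n.

(* Half the trace of the square of the commutator of A and B. *)
Definition comm_defect A B : R := \tr (A *m B *m (A *m B)) - \tr (A *m A *m (B *m B)).

Lemma comm_defectC A B : comm_defect A B = comm_defect B A.
Proof.
rewrite /comm_defect [X in _ - X]mxtrace_mulC; congr (_ - _).
by rewrite -mulmxA mxtrace_mulC !mulmxA.
Qed.

Lemma comm_defect0 A B : A *m B = B *m A -> comm_defect A B = 0.
Proof.
move=> c; rewrite /comm_defect -(mulmxA A B) (mulmxA B A) -c !mulmxA.
exact: subrr.
Qed.

Lemma comm_defectDl A B a : comm_defect (A + a *: 1%:M) B = comm_defect A B.
Proof.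
rewrite /comm_defect !(mulmxDl, mulmxDr, =^~ scalemxAl, =^~ scalemxAr, mul1mx, mulmx1).
rewrite !(mxtraceD, mxtraceZ) !mulmxA.
have -> : \tr (B *m A *m B) = \tr (A *m B *m B) by rewrite -mulmxA mxtrace_mulC.
by ring.
Qed.

Lemma comm_defect_shift A B a b :
  comm_defect (A + a *: 1%:M) (B + b *: 1%:M) = comm_defect A B.
Proof. by rewrite comm_defectDl comm_defectC comm_defectDl comm_defectC. Qed.

End comm_defect.

(** * Traces and commutators of the matrices E_ij *)

Section Emx.
Context (R : realType) (n : nat).
Implicit Types i j k l : 'I_n.
Local Notation E := (@Emx R n).
Local Notation c := ((Num.sqrt 2)^-1 : R).

Lemma sqrt2V2 : c * c = 2^-1.
Proof. by rewrite -invfM -expr2 sqr_sqrtr. Qed.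

Lemma EmxC i j : E i j = E j i.
Proof. by rewrite /Emx eq_sym addrC; case: eqVneq => [->|]. Qed.

Lemma Emx_diag i : E i i = delta_mx i i.
Proof. by rewrite /Emx eqxx. Qed.

Lemma Emx_off i j : i != j -> E i j = c *: (delta_mx i j + delta_mx j i).
Proof. by move=> ij; rewrite /Emx (negPf ij). Qed.

Lemma Emx_Sym i j : E i j \in Sym R n.
Proof.
apply/SymP; have [<-|ij] := eqVneq i j; first by rewrite Emx_diag trmx_delta.
by rewrite Emx_off// linearZ /= linearD /= !trmx_delta addrC.
Qed.

Lemma mxtrace_delta i j : \tr (delta_mx i j : 'M[R]_n) = (i == j)%:R.
Proof.
rewrite /mxtrace (bigD1 i)//= big1 => [|k ki]; rewrite !mxE ?eqxx ?addr0//.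
by rewrite (negPf ki).
Qed.

Lemma mxtrace_Emx i j : \tr (E i j) = (i == j)%:R.
Proof.
have [<-|ij] := eqVneq i j; first by rewrite Emx_diag mxtrace_delta eqxx.
by rewrite Emx_off// mxtraceZ mxtraceD !mxtrace_delta (eq_sym j) (negPf ij) addr0 mulr0.
Qed.

(** Orthonormality for the trace form. The ordering of the indices excludes the crossed match i = l,
    j = k of two off-diagonal elements. *)
Lemma mxtrace_Emx_mul i j k l : (i <= j)%N -> (k <= l)%N ->
  \tr (E i j *m E k l) = ((i, j) == (k, l))%:R.
Proof.
move=> ij kl.
have T a b c d : \tr (delta_mx a b *m delta_mx c d : 'M[R]_n)
    = ((b == c) && (a == d))%:R.
  by rewrite mul_delta_mx_cond raddfMn /= mxtrace_delta mulrb; case: (b == c).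
rewrite xpair_eqE.
have [eij|nij] := eqVneq i j; have [ekl|nkl] := eqVneq k l.
- by rewrite -eij -ekl !Emx_diag T.
- rewrite -eij Emx_diag Emx_off// -scalemxAr mulmxDr mxtraceZ mxtraceD !T.
  have [ik|ik] := eqVneq i k; have [il|il] := eqVneq i l; rewrite /= ?addr0 ?mulr0//.
  by rewrite -ik -il eqxx in nkl.
- rewrite -ekl Emx_diag Emx_off// -scalemxAl mulmxDl mxtraceZ mxtraceD !T.
  have [ik|ik] := eqVneq i k; have [jk|jk] := eqVneq j k; rewrite /= ?addr0 ?mulr0//.
  by rewrite ik jk eqxx in nij.
rewrite !Emx_off// -scalemxAl -scalemxAr !mulmxDl !mulmxDr !mxtraceZ !mxtraceD !T.
rewrite mulrA sqrt2V2 !(andbC (j == _)).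
have lij : (i < j)%N by rewrite ltn_neqAle ij andbT.
have lkl : (k < l)%N by rewrite ltn_neqAle kl andbT.
have -> : (i == l) && (j == k) = false.
  apply/negP => /andP[/eqP il /eqP jk]; move: lij; rewrite il jk ltnNge.
  by rewrite (ltnW lkl).
case: (_ && _); rewrite ?add0r ?addr0 ?mulr0//.
by field.
Qed.

(** E_ii E_ij is a multiple of C_ij, whose square is 0, while E_ii^2 E_ij^2 = C_ii / 2. *)
Lemma comm_defect_diag_off i j : i != j -> comm_defect (E i i) (E i j) = - 2^-1.
Proof.
move=> ij; have ji : j != i by rewrite eq_sym.
rewrite /comm_defect Emx_diag Emx_off// -!scalemxAr -!scalemxAl -!scalemxAr !scalerA sqrt2V2.
rewrite !(mulmxDl, mulmxDr, mul_delta_mx_cond, eqxx, negPf ij, negPf ji, mulr1n, mulr0n,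
  mul0mx, mulmx0, addr0, add0r, scaler0).
by rewrite mxtrace0 mxtraceZ mxtrace_delta eqxx mulr1 sub0r.
Qed.

(** E_ij E_ik = C_jk / 2 has square 0, while E_ij^2 E_ik^2 = C_ii / 4. *)
Lemma comm_defect_off_off i j k : i != j -> i != k -> j != k ->
  comm_defect (E i j) (E i k) = - 4^-1.
Proof.
move=> ij ik jk.
have ji : j != i by rewrite eq_sym.
have ki : k != i by rewrite eq_sym.
have kj : k != j by rewrite eq_sym.
rewrite /comm_defect !Emx_off//.
rewrite -!scalemxAr -!scalemxAl -!scalemxAr !scalerA sqrt2V2.
rewrite !(mulmxDl, mulmxDr, mul_delta_mx_cond, eqxx, negPf ij, negPf ji, negPf ik,
  negPf ki, negPf jk, negPf kj, mulr1n, mulr0n, mul0mx, mulmx0, addr0, add0r, scaler0).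
by rewrite mxtrace0 mxtraceZ mxtrace_delta eqxx mulr1 sub0r -mulrA sqrt2V2; field.
Qed.

Lemma Emx_mul_disjoint i j k l : i != k -> i != l -> j != k -> j != l ->
  E i j *m E k l = 0.
Proof.
move=> ik il jk jl; rewrite /Emx.
by case: (i == j); case: (k == l);
  rewrite -?scalemxAr -?scalemxAl !(mulmxDl, mulmxDr, mul_delta_mx_0) ?addr0 ?scaler0.
Qed.

(** Two distinct elements with a common index share exactly one. That pair is of the first excluded
    kind if one element is diagonal and of the second if neither is. Otherwise the indices are
    disjoint and both products vanish. *)
Lemma comm_defect_Emx0 i j k l : (i <= j)%N -> (k <= l)%N -> (i, j) != (k, l) ->
  (forall a b : 'I_n, a != b ->
     [set [set i; j]; [set k; l]]%SET <> [set [set a; a]; [set a; b]]%SET) ->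
  (forall a b c : 'I_n, a != b -> a != c -> b != c ->
     [set [set i; j]; [set k; l]]%SET <> [set [set a; b]; [set a; c]]%SET) ->
  comm_defect (E i j) (E k l) = 0.
Proof.
move=> ij kl ne h1 h2; apply: comm_defect0.
have disj : i != k -> i != l -> j != k -> j != l -> E i j *m E k l = E k l *m E i j.
  by move=> ik il jk jl; rewrite !Emx_mul_disjoint// eq_sym.
have [eij|nij] := eqVneq i j.
  subst j; have [ekl|nkl] := eqVneq k l.
    subst l; have [<-//|ik] := eqVneq i k.
    exact: disj.
  have ik : i != k.
    by apply/eqP => e; subst k; exact: h1 nkl erefl.
  have il : i != l.
    apply/eqP => e; subst l; apply: (h1 i k); first by rewrite eq_sym.
    by rewrite (finset.setUC [set k]).
  exact: disj.
have [ekl|nkl] := eqVneq k l.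
  subst l.
  have ik : i != k.
    by apply/eqP => e; subst k; apply: (h1 i j nij); rewrite finset.setUC.
  have jk : j != k.
    apply/eqP => e; subst k; apply: (h1 j i); first by rewrite eq_sym.
    by rewrite finset.setUC (finset.setUC [set i]).
  exact: disj.
have nji : j != i by rewrite eq_sym.
have nlk : l != k by rewrite eq_sym.
have lij : (i < j)%N by rewrite ltn_neqAle nij.
have lkl : (k < l)%N by rewrite ltn_neqAle nkl.
have [ik|ik] := eqVneq i k.
  subst k; have jl : j != l by apply: contraNneq ne => ->.
  by case: (h2 i j l).
have [jl|jl] := eqVneq j l.
  subst l; case: (h2 j i k) => //; try by rewrite eq_sym.
  by rewrite (finset.setUC [set i]) (finset.setUC [set k]).
have [il|il] := eqVneq i l.
  (* With i = l, also having j = k would give the same element with its indices reversed, against i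
     < j and k < l. *)
  subst l; have jk : j != k.
    by apply: contraTneq lij => ->; rewrite -leqNgt ltnW.
  case: (h2 i j k) => //.
  by rewrite (finset.setUC [set k]).
have [jk|jk] := eqVneq j k.
  subst k; case: (h2 j i l) => //.
  by rewrite (finset.setUC [set i]).
exact: disj.
Qed.

Lemma mxtrace_Emx_sqr i j : \tr (E i j *m E i j) = 1.
Proof.
wlog ij : i j / (i <= j)%N.
  by move=> h; case: (leqP i j) => [|/ltnW] /h//; rewrite EmxC.
by rewrite mxtrace_Emx_mul// eqxx.
Qed.

Lemma mxtrace_Emx_off i j k : i != j -> j != k -> \tr (E i j *m E i k) = 0.
Proof.
move=> ij jk; have ji : j != i by rewrite eq_sym.
case: (leqP i j) => [ij'|/ltnW ji']; case: (leqP i k) => [ik'|/ltnW ki'].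
- by rewrite mxtrace_Emx_mul// xpair_eqE (negPf jk) andbF.
- by rewrite (EmxC i k) mxtrace_Emx_mul// xpair_eqE (negPf ji) andbF.
- by rewrite (EmxC i j) mxtrace_Emx_mul// xpair_eqE (negPf ji).
- by rewrite (EmxC i j) (EmxC i k) mxtrace_Emx_mul// xpair_eqE (negPf jk).
Qed.

End Emx.

(** * The basis at an arbitrary point *)

Section Ebeta.
Context (R : realType) (n : nat) (n_gt0 : (0 < n)%N) (alpha beta : R)
  (alpha_gt0 : 0 < alpha) (beta_gt : - alpha / n%:R < beta).
Implicit Types (i j k l : 'I_n) (S A B : 'M[R]_n).
Local Notation E := (@Emx R n).
Local Notation p := (pscale n alpha beta).
Local Notation g := (@affine_metric R n alpha beta).

Lemma dim_gt0 : 0 < n%:R :> R. Proof. by rewrite ltr0n. Qed.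

Lemma pscale_arg_gt0 : 0 < (alpha + n%:R * beta) / alpha.
Proof.
rewrite divr_gt0//.
by move: beta_gt; rewrite ltr_pdivrMr ?dim_gt0// => h; lra.
Qed.

Lemma pscale_gt0 : 0 < p.
Proof. by rewrite sqrtr_gt0 pscale_arg_gt0. Qed.

Lemma sqr_pscale : p ^+ 2 = (alpha + n%:R * beta) / alpha.
Proof. by rewrite sqr_sqrtr// ltW// pscale_arg_gt0. Qed.

Lemma Ebeta_Sym i j : Ebeta alpha beta i j \in Sym R n.
Proof.
rewrite memvD ?Emx_Sym// memvZ//; apply/SymP; exact: trmx1.
Qed.

Lemma EbetaC i j : Ebeta alpha beta i j = Ebeta alpha beta j i.
Proof. by rewrite /Ebeta EmxC eq_sym. Qed.

(* The shift by a multiple of the identity is chosen so that the beta-term of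
   the metric cancels: p^2 = 1 + n beta / alpha. *)
Lemma Ebeta_inner i j k l :
  alpha * \tr (Ebeta alpha beta i j *m Ebeta alpha beta k l)
    + beta * (\tr (Ebeta alpha beta i j) * \tr (Ebeta alpha beta k l))
  = alpha * \tr (E i j *m E k l).
Proof.
have n0 := lt0r_neq0 dim_gt0; have p0 := lt0r_neq0 pscale_gt0.
have a0 := lt0r_neq0 alpha_gt0.
have bE : beta = alpha * (p ^+ 2 - 1) / n%:R by rewrite sqr_pscale; field; rewrite a0 n0.
rewrite /Ebeta; set s := (1 - p) / (n%:R * p).
rewrite !(mulmxDl, mulmxDr, =^~ scalemxAl, =^~ scalemxAr, mul1mx, mulmx1).
rewrite !(mxtraceD, mxtraceZ) mxtrace1 !mxtrace_Emx bE /s.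
by case: (i == j); case: (k == l) => /=; field; rewrite n0 p0.
Qed.

Lemma basis_vec_inner S i j k l : SPD S ->
  g S (basis_vec alpha beta S i j) (basis_vec alpha beta S k l)
    = alpha * \tr (E i j *m E k l).
Proof. by move=> Sp; rewrite affine_metric_sqrt// Ebeta_inner. Qed.

Lemma sqrt_conj_Sym S A : SPD S -> A \in Sym R n ->
  sqrtSPD S *m A *m sqrtSPD S \in Sym R n.
Proof.
move=> Sp /SymP As; apply/SymP.
by rewrite !trmx_mul As sqrtSPD_sym// mulmxA.
Qed.

Lemma basis_vec_Sym S i j : SPD S -> basis_vec alpha beta S i j \in Sym R n.
Proof. by move=> Sp; exact: sqrt_conj_Sym (Ebeta_Sym i j). Qed.

(** With Q = S^(1/2) one has S^-1 (Q A Q) = Q^-1 A Q, so the matrices x, y of the curvature formula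
    are A, B under one common similarity, which traces ignore. *)
Lemma curvature_form_sqrt S A B : SPD S -> A \in Sym R n -> B \in Sym R n ->
  curvature_form g S (sqrtSPD S *m A *m sqrtSPD S) (sqrtSPD S *m B *m sqrtSPD S)
    = alpha / 2 * comm_defect A B.
Proof.
move=> Sp As Bs; have Qu := sqrtSPD_unit Sp.
rewrite curvature_formE ?sqrt_conj_Sym//.
have conjE C : invmx S *m (sqrtSPD S *m C *m sqrtSPD S)
    = invmx (sqrtSPD S) *m C *m sqrtSPD S.
  by rewrite invmx_sqrtSPD// -!mulmxA mulKmx.
have conjM C D : invmx (sqrtSPD S) *m C *m sqrtSPD S
    *m (invmx (sqrtSPD S) *m D *m sqrtSPD S)
    = invmx (sqrtSPD S) *m (C *m D) *m sqrtSPD S.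
  by rewrite !mulmxA mulmxK.
have conj_tr C : \tr (invmx (sqrtSPD S) *m C *m sqrtSPD S) = \tr C.
  by rewrite mxtrace_mulC mulKVmx.
by rewrite !conjE !conjM !conj_tr.
Qed.

Lemma sectional_curvature_basis S i j k l : SPD S ->
  sectional_curvature g S (basis_vec alpha beta S i j) (basis_vec alpha beta S k l)
    = comm_defect (E i j) (E k l) / (2 * alpha)
      / (\tr (E i j *m E i j) * \tr (E k l *m E k l) - \tr (E i j *m E k l) ^+ 2).
Proof.
move=> Sp; rewrite /sectional_curvature !basis_vec_inner//.
rewrite curvature_form_sqrt ?Ebeta_Sym// comm_defect_shift.
set t1 := \tr _; set t2 := \tr _; set t3 := \tr _.
have -> : alpha * t1 * (alpha * t2) - (alpha * t3) ^+ 2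
  = alpha ^+ 2 * (t1 * t2 - t3 ^+ 2) by ring.
have a0 := lt0r_neq0 alpha_gt0.
(* The inverse of the Gram determinant stays abstract because that determinant is 0 when the two
   vectors coincide. *)
by rewrite invfM; move: (t1 * t2 - t3 ^+ 2)^-1 => d; field.
Qed.

(** The family is orthogonal for g, so pairing a vanishing combination with its m-th member isolates
    alpha times the m-th coefficient. *)
Lemma basis_seq_free S : SPD S -> free (basis_seq alpha beta S).
Proof.
move=> Sp; rewrite /basis_seq.
set s := enum _; pose f (ij : 'I_n * 'I_n) := basis_vec alpha beta S ij.1 ij.2.
rewrite -/f; rewrite -[map _ _]in_tupleE; apply/freeP => c c0 m.
pose x0 := (Ordinal n_gt0, Ordinal n_gt0).
have us : uniq s := enum_uniq _.
have le_s a : (a < size s)%N -> ((nth x0 s a).1 <= (nth x0 s a).2)%N.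
  by move=> /(mem_nth x0); rewrite mem_enum.
have nthE (a : 'I_(size (map f s))) : (in_tuple (map f s))`_a = f (nth x0 s a).
  by rewrite /= (nth_map x0)// -(size_map f).
have gsum (I : finType) (F : I -> 'M[R]_n) A : g S (\sum_a F a) A = \sum_a g S (F a) A.
  apply: (big_morph (fun B => g S B A)) => [B C|]; first exact: affine_metricDl.
  by rewrite -(scale0r 0) affine_metricZl mul0r.
have lt_s (a : 'I_(size (map f s))) : (a < size s)%N by rewrite -(size_map f).
have : g S (\sum_a c a *: (in_tuple (map f s))`_a) (f (nth x0 s m)) = 0.
  by rewrite c0 -(scale0r 0) affine_metricZl mul0r.
rewrite gsum (bigD1 m)//= big1 => [|a am]; last first.
  rewrite affine_metricZl nthE basis_vec_inner// mxtrace_Emx_mul ?le_s//.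
  by rewrite -!surjective_pairing nth_uniq// (inj_eq val_inj) (negPf am) !mulr0.
rewrite addr0 affine_metricZl nthE basis_vec_inner// mxtrace_Emx_mul ?le_s//.
rewrite eqxx mulr1 => /eqP; rewrite mulf_eq0 (gt_eqF alpha_gt0) orbF.
by move/eqP.
Qed.

(** For the spanning half, the image of the identity under congruence by S^(1/2) is recovered from
    the diagonal vectors. Removing the shifts then gives the images of the E_ij, hence those of all
    symmetric matrices. *)
Lemma basis_seq_basis S : SPD S -> basis_of (Sym R n) (basis_seq alpha beta S).
Proof.
move=> Sp; rewrite /basis_of basis_seq_free// andbT eqEsubv; apply/andP; split.
  apply/span_subvP => _ /mapP[ij _ ->]; exact: basis_vec_Sym.
have Qu := sqrtSPD_unit Sp.
set W := <<_>>%VS; pose phi M := sqrtSPD S *m M *m sqrtSPD S.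
have phiZ a M : phi (a *: M) = a *: phi M by rewrite /phi -scalemxAr -scalemxAl.
have phiD M N : phi (M + N) = phi M + phi N by rewrite /phi mulmxDr mulmxDl.
have phi_sum (I : finType) (F : I -> 'M[R]_n) : phi (\sum_a F a) = \sum_a phi (F a).
  by apply: (big_morph phi) => //; rewrite /phi mulmx0 mul0mx.
have WEb i j : phi (Ebeta alpha beta i j) \in W.
  wlog ij : i j / (i <= j)%N.
    by move=> h; case: (leqP i j) => [|/ltnW] /h//; rewrite EbetaC.
  by apply: memv_span; apply/mapP; exists (i, j); rewrite ?mem_enum.
have p0 := lt0r_neq0 pscale_gt0; have n0 := lt0r_neq0 dim_gt0.
have W1 : phi 1%:M \in W.
  (* The E_ii sum to I and the n shifts add (1-p)/p times I, so the E^beta_ii sum to I/p. *)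
  have -> : 1%:M = p *: \sum_(i < n) Ebeta alpha beta i i.
    under eq_bigr do rewrite /Ebeta eqxx mulr1 Emx_diag.
    rewrite big_split /= -mx1_sum_delta.
    rewrite sumr_const card_ord -[_ *+ n]scaler_nat scalerA.
    rewrite -[X in _ *: (X + _)]scale1r -scalerDl scalerA -[LHS]scale1r.
    congr (_ *: _).
    by field; rewrite p0 n0.
  by rewrite phiZ memvZ// phi_sum memv_suml.
have WE i j : phi (E i j) \in W.
  have -> : E i j = Ebeta alpha beta i j
      + (- ((1 - p) / (n%:R * p) * (i == j)%:R)) *: 1%:M.
    by rewrite /Ebeta scaleNr addrK.
  by rewrite phiD memvD// phiZ memvZ.
have Wd i j : phi (delta_mx i j + delta_mx j i) \in W.
  have [<-|ij] := eqVneq i j.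
    by rewrite -Emx_diag phiD memvD.
  have -> : delta_mx i j + delta_mx j i = Num.sqrt 2 *: E i j.
    by rewrite Emx_off// scalerA mulfV ?scale1r// sqrtr_eq0 -ltNge.
  by rewrite phiZ memvZ.
apply/subvP => A As; pose M := invmx (sqrtSPD S) *m A *m invmx (sqrtSPD S).
have -> : A = phi M by rewrite /phi /M !mulmxA mulmxV// mul1mx mulmxKV.
have Ms : M^T = M.
  have /SymP At := As.
  by rewrite /M !trmx_mul At trmx_inv sqrtSPD_sym// mulmxA.
have -> : M = 2^-1 *: \sum_i \sum_j M i j *: (delta_mx i j + delta_mx j i).
  under eq_bigr do under eq_bigr do rewrite scalerDr.
  under eq_bigr do rewrite big_split /=.
  rewrite big_split /= -matrix_sum_delta exchange_big /=.
  have -> : \sum_j \sum_i M i j *: delta_mx j i = M.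
    rewrite [RHS]matrix_sum_delta; apply: eq_bigr => j _; apply: eq_bigr => i _.
    by rewrite -[in RHS]Ms [X in _ = X *: _]mxE.
  by rewrite -mulr2n -[M *+ 2]scaler_nat scalerA mulVf ?scale1r// pnatr_eq0.
rewrite phiZ memvZ// phi_sum memv_suml// => i _; rewrite phi_sum memv_suml// => j _.
by rewrite phiZ memvZ.
Qed.

End Ebeta.

(* The pair {B i j, B k l} of basis elements is encoded by the unordered pair
   of unordered pairs {{i, j}, {k, l}}, since B i j = B j i. *)
Theorem mainTheorem2 (R : realType) (n : nat) (n_gt0 : (0 < n)%N)
    (alpha beta : R) (alpha_gt0 : 0 < alpha) (beta_gt : - alpha / n%:R < beta)
    (S : 'M[R]_n) (S_spd : SPD S) :
  let kappa := sectional_curvature (@affine_metric R n alpha beta) S in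
  let B := @basis_vec R n alpha beta S in
  [/\ basis_of (Sym R n) (basis_seq alpha beta S),
      forall i j : 'I_n, i != j ->
        kappa (B i i) (B i j) = - (1 / (4 * alpha)),
      forall i j k : 'I_n, i != j -> i != k -> j != k ->
        kappa (B i j) (B i k) = - (1 / (8 * alpha))
    & forall i j k l : 'I_n, (i <= j)%N -> (k <= l)%N -> (i, j) != (k, l) ->
        (forall a b : 'I_n, a != b ->
           [set [set i; j]; [set k; l]]%SET
             <> [set [set a; a]; [set a; b]]%SET) ->
        (forall a b c : 'I_n, a != b -> a != c -> b != c ->
           [set [set i; j]; [set k; l]]%SET
             <> [set [set a; b]; [set a; c]]%SET) ->
        kappa (B i j) (B k l) = 0 ].
Proof.
have a0 : alpha != 0 by rewrite gt_eqF.
have kappaE := sectional_curvature_basis n_gt0 alpha_gt0 beta_gt _ _ _ _ S_spd.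
split=> [|i j ij|i j k ij ik jk|i j k l ij kl ne h1 h2].
- exact: basis_seq_basis.
- rewrite kappaE comm_defect_diag_off// !mxtrace_Emx_sqr.
  have -> : \tr (Emx R i i *m Emx R i j) = 0.
    by rewrite mxtrace_mulC mxtrace_Emx_off// eq_sym.
  by field; rewrite a0.
- rewrite kappaE comm_defect_off_off// !mxtrace_Emx_sqr mxtrace_Emx_off//.
  by field; rewrite a0.
by rewrite kappaE comm_defect_Emx0// !mul0r.
Qed.
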